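(* Let $(a_n)_{n\in\mathbb N}$ be any increasing sequence of positive real numbers with $a_n\nearrow\infty$. Then there exist a smoothly bounded pseudoconvex domain $\Omega\subset\subset\mathbb C^3$ of infinite type, a boundary point $P\in\partial\Omega$, and a sequence of positive numbers $\delta_n\searrow 0$ such that, writing $\nu$ for the unit outward normal vector to $\partial\Omega$ at $P$ and $P_{\delta_n}=P-\delta_n\nu$, one has $P_{\delta_n}\in\Omega$ and $$F_K(P_{\delta_n},\nu)\le \frac{1}{a_n\delta_n}\qquad\text{for all } n\in\mathbb N,$$ where $F_K$ denotes the Kobayashi metric of $\Omega$.
   Context: Let $\mathbb D$ be the unit disc in $\mathbb C$. For a domain $\Omega\subset\mathbb C^N$, a point $Q\in\Omega$ and a tangent vector $X\in T_Q(\Omega)$ (identified with a vector in $\mathbb C^N$), the Kobayashi metric is $$F_K(Q,X)=\inf\{\alpha>0:\ \exists\,\phi:\mathbb D\to\Omega \text{ holomorphic with } \phi(0)=Q,\ \phi'(0)=X/\alpha\}.$$ A smoothly bounded domain is a bounded domain $\Omega=\{r<0\}$ with $C^\infty$ boundary; its unit outward normal vector at $P\in\partial\Omega$ is $\nu=\nabla r(P)/\|\nabla r(P)\|$, regarded as a vector in $\mathbb C^N$. The domain is of infinite type if some boundary point is not of finite type (in the sense of D'Angelo), i.e. the order of contact of (possibly singular) one-dimensional complex analytic varieties with $\partial\Omega$ at that point is unbounded. *)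

(* Defs.v *)
From HB Require Import structures.
From mathcomp Require Import all_boot all_order all_algebra.
From mathcomp Require Import all_classical all_reals all_analysis.
From mathcomp Require Import complex.
Set Implicit Arguments.
Unset Strict Implicit.
Unset Printing Implicit Defensive.
Import Order.TTheory GRing.Theory Num.Theory.
Import numFieldNormedType.Exports.
Local Open Scope classical_set_scope.
Local Open Scope complex_scope.
Local Open Scope ring_scope.

(* R[i] gets the topology of its modulus, as a normed module over itself. *)
HB.instance Definition _ (R : realType) := NormedModule.copy R[i] R[i]^o.

Section RealDerivatives.
Context {R : realType} {E : normedModType R[i]}.
Implicit Types (f : E -> R) (v z : E) (vs : seq E).

Definition rderivable v f z : Prop :=
  derivable (fun t : R => f (z + t%:C *: v)) 0 1.

(* Derivative of a real function along v, with E seen as a real vector space;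
   E itself only carries a complex structure, hence the restriction to a real
   line. *)
Definition rderive v f : E -> R :=
  fun z => derive1 (fun t : R => f (z + t%:C *: v)) 0.

Definition rderives vs f : E -> R := foldr rderive f vs.

(* C^oo: all iterated directional derivatives exist and are continuous. *)
Definition smooth f : Prop :=
  forall vs, continuous (rderives vs f) /\
             forall v z, rderivable v (rderives vs f) z.

Definition vanishes_to_order (k : nat) f z : Prop :=
  forall vs, (size vs < k)%N -> rderives vs f z = 0.

End RealDerivatives.

Section ComplexSpace.
Context {R : realType} {n : nat}.
Local Notation C := R[i].
Local Notation Cn := 'rV[C]_n.
Implicit Types (Omega : set Cn) (r : Cn -> R) (P Q X w : Cn).

Definition basis_vec (j : 'I_n) : Cn := delta_mx 0 j.

(* The norm of 'rV in the library is the sup norm. *)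
Definition euclidean_norm w : R :=
  Num.sqrt (\sum_j (complex.Re (w 0 j) ^+ 2 + complex.Im (w 0 j) ^+ 2)).

(* The real gradient, (dr/dx_j, dr/dy_j)_j being identified with the complex
   vector (dr/dx_j + i dr/dy_j)_j. *)
Definition gradient r P : Cn :=
  \row_j (rderive (basis_vec j) r P +i* rderive ('i *: basis_vec j) r P).

Definition unit_outward_normal r P : Cn :=
  ((euclidean_norm (gradient r P))^-1)%:C *: gradient r P.

Definition cderive w (f : Cn -> C) : Cn -> C :=
  fun z => rderive w (fun x => complex.Re (f x)) z +i* rderive w (fun x => complex.Im (f x)) z.

(* Wirtinger operators d/dz_j and d/d(conj z_j). *)
Definition d_z (j : 'I_n) (f : Cn -> C) : Cn -> C := fun z =>
  2^-1 * (cderive (basis_vec j) f z - 'i * cderive ('i *: basis_vec j) f z).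
Definition d_zbar (j : 'I_n) (f : Cn -> C) : Cn -> C := fun z =>
  2^-1 * (cderive (basis_vec j) f z + 'i * cderive ('i *: basis_vec j) f z).

Definition complex_tangent r P w : Prop :=
  \sum_j d_z j (fun x => (r x)%:C) P * w 0 j = 0.

Definition levi_form r P w : C :=
  \sum_j \sum_k d_z j (d_zbar k (fun x => (r x)%:C)) P * w 0 j * (w 0 k)^*.

Definition boundary Omega : set Cn := closure Omega `\` interior Omega.

Definition bounded_domain Omega : Prop :=
  [/\ Omega !=set0, open Omega, connected Omega & bounded_set Omega].

(* With smooth r and a nonvanishing gradient on the boundary, the boundary is a
   smooth real hypersurface. *)
Definition defining_function r Omega : Prop :=
  [/\ smooth r, Omega = [set z | r z < 0] &
      forall P, boundary Omega P -> gradient r P <> 0].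

(* Levi pseudoconvexity, the form being restricted to complex tangent vectors;
   the order on R[i] makes 0 <= levi_form say that the form is real and
   nonnegative. *)
Definition pseudoconvex r Omega : Prop :=
  forall P, boundary Omega P ->
  forall w, complex_tangent r P w -> 0 <= levi_form r P w.

Definition holomorphic_on (U : set C) (phi : C -> Cn) : Prop :=
  forall z, U z -> derivable phi z 1.

(* A (possibly singular) parametrized analytic curve germ through P; m is the
   order of vanishing of phi - P at 0. *)
Definition curve_germ P (m : nat) (phi : C -> Cn) : Prop :=
  [/\ exists2 U : set C, nbhs 0 U & holomorphic_on U phi,
      phi 0 = P,
      (0 < m)%N,
      forall j, (0 < j < m)%N -> derive1n j phi 0 = 0 &
      derive1n m phi 0 <> 0].

(* The supremum over curve germs phi of ord (r o phi) / ord (phi - P); k ranges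
   over the lower bounds of ord (r o phi), which may be infinite. *)
Definition dAngelo_type r P : \bar R :=
  ereal_sup [set x | exists phi m k,
    [/\ curve_germ P m phi, vanishes_to_order k (fun z : C => r (phi z)) 0 &
        x = (k%:R / m%:R)%:E]].

Definition finite_type_at r P : Prop := (dAngelo_type r P < +oo)%E.

Definition infinite_type r Omega : Prop :=
  exists2 P, boundary Omega P & ~ finite_type_at r P.

Definition unit_disc : set C := [set z | `|z| < 1].

Definition kobayashi_metric Omega Q X : \bar R :=
  ereal_inf [set alpha%:E | alpha in [set alpha : R | 0 < alpha /\
    exists phi : C -> Cn,
      [/\ holomorphic_on unit_disc phi,
          forall z, unit_disc z -> Omega (phi z),
          phi 0 = Q &
          derive1 phi 0 = (alpha^-1)%:C *: X]]].

End ComplexSpace.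

(* Main.v *)
Require Import Defs.
From HB Require Import structures.
From mathcomp Require Import all_boot all_order all_algebra.
From mathcomp Require Import all_classical all_reals all_analysis.
From mathcomp Require Import complex.
From mathcomp Require Import ring lra.
Set Implicit Arguments.
Unset Strict Implicit.
Unset Printing Implicit Defensive.
Import Order.TTheory GRing.Theory Num.Theory.
Import numFieldNormedType.Exports.
Local Open Scope classical_set_scope.
Local Open Scope complex_scope.
Local Open Scope ring_scope.

(* The domain is |w|^2 exp (psi z_1) + |z_2|^2 + chi (|z_1|^2) < 1, with chi
   convex and flat on the unit disc and psi smooth and subharmonic in one
   variable; P = (0, 0, 1).  The point (0, 1, 0) lies on an analytic disc of the
   boundary.  psi = sum_n d_n T_n, where T_n is ln |1 + z/s_n|^2 - 2 Re (z/s_n)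
   smoothed near its pole -s_n, so T_n is harmonic near 0.  For the polynomial
   f (x) = (1 - x/N)^(N^2) (1 + N x), an approximation of exp (-N x) (1 + N x)
   which has no linear term at 0, the disc z = s_n (f (x) - 1) is singular at the
   origin, while T_n is at most -2 N Re x + O (ln N) - 2 Re (f (x) - 1) along it.
   Hence w may have derivative about d_n N at 0 although 1 - w (0) is only of
   order d_n ln N, and N / ln N is at our disposal.  The scales s_n shrink so fast
   that the disc stays where T_m is harmonic for all m < n: there T_m is the real
   part of a holomorphic function up to an error d_n, absorbed in the exponent of
   w.  The weights d_n shrink so fast that the terms m > n are negligible and
   that psi is smooth. *)

(** The gain comes from a zero of the profile. Since [nu] is the [w] direction, the first component
    of a competing disc has zero derivative at the origin. A harmonic [psi] composed with it would
    have no linear term, and [w] could gain no derivative from it. The profile vanishes at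
    [x = -1/N], where the disc runs into the pole of [T_n]. There [T_n] is strongly negative, so a
    harmonic majorant of it along the disc may have the linear term [-2 N Re x], although [T_n]
    along the disc has none. The price is the gap between majorant and function at the origin, of
    order [d_n ln N], and this is what [delta_n] pays for. Both [delta_n] and the derivative of [w]
    are proportional to [d_n], so the comparison with [a_n] involves [N] alone. Hence there is no
    circularity: [a_n] fixes [N], then [N] fixes smoothing radius and scale, and the weights come
    last, as small as smoothness of [psi] requires. Subtracting [2 Re (z/s_n)] kills the gradient of
    [T_n] at 0 and so keeps the normal at [P] on the [w] axis. Powers [(1 + y/k)^k] replace
    exponentials throughout, so every disc is polynomial. *)

Lemma is_derive1P (R : realType) (f : R -> R) (x l : R) :
  is_derive x 1 f l <->
  forall e : R, 0 < e -> exists2 d : R, 0 < d &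
    forall h, `|h| < d -> `|f (x + h) - f x - h * l| <= e * `|h|.
Proof.
split=> [df e e0|H].
- have /cvgrPdist_le /(_ e e0) : h^-1 *: ((f \o shift x) (h *: (1 : R)) - f x) @[h --> 0^'] --> l.
    by move: (@derive_val _ _ _ _ _ _ _ df) => <-; exact: (@ex_derive _ _ _ _ _ _ _ df).
  move=> /nbhs_ballP[d d0 dH]; exists d => // h hd.
  have [->|h0] := eqVneq h 0; first by rewrite addr0 subrr mul0r subrr !normr0 mulr0.
  have := dH h; rewrite /ball/= sub0r normrN => /(_ hd h0).
  rewrite -(ler_pM2r (x := `|h|)) ?normr_gt0// -normrM.
  rewrite [h *: _]mulr1 /= (addrC h x) mulrBl mulrAC mulVf// mul1r distrC.
  by rewrite [l * h]mulrC.
- have cv : h^-1 *: ((f \o shift x) (h *: (1 : R)) - f x) @[h --> 0^'] --> l.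
    apply/cvgrPdist_le => e e0; have [d d0 dH] := H e e0.
    apply/nbhs_ballP; exists d => // h; rewrite /ball/= sub0r normrN => hd h0.
    rewrite -(ler_pM2r (x := `|h|)) ?normr_gt0// -normrM.
    rewrite [h *: _]mulr1 /= (addrC h x) mulrBl mulrAC mulVf// mul1r distrC.
    by rewrite [l * h]mulrC; exact: dH.
  apply: DeriveDef; first by apply/cvg_ex; exists l.
  exact/cvg_lim.
Qed.

(** * Derivatives along real lines *)

Section LineCalculus.
Context {R : realType} {E : normedModType R[i]}.
Implicit Types (f g : E -> R) (u v z : E) (a b s t l : R).

Definition rd v f z l := is_derive (0 : R) 1 (fun t : R => f (z + t%:C *: v)) l.

Lemma rdE v f z l : rd v f z l -> rderive v f z = l.
Proof. by rewrite /rderive derive1E => -[]. Qed.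

Lemma rd_derivable v f z l : rd v f z l -> rderivable v f z.
Proof. by case. Qed.

Lemma rdP v f z : rderivable v f z -> rd v f z (rderive v f z).
Proof. by move=> df; apply: DeriveDef => //; rewrite /rderive derive1E. Qed.

Lemma rd_line v f z s l : rd v f (z + s%:C *: v) l ->
  is_derive s 1 (fun t : R => f (z + t%:C *: v)) l.
Proof.
move=> /is_derive1P H; apply/is_derive1P => e /H[d d0 {}H]; exists d => // h /H.
by rewrite add0r scale0r addr0 rmorphD/= scalerDl addrA.
Qed.

Lemma cvg_real_complex (t0 : R) : t%:C @[t --> t0] --> (t0%:C : R[i]).
Proof.
apply/cvgrPdist_lt => e e0; move: (e0); rewrite ltcE/= => /andP[/eqP ei eR].
near=> t; rewrite -rmorphB/= normc_def/= expr0n/= addr0 sqrtr_sqr.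
rewrite ltcE/= ei eqxx/=; near: t.
by apply: cvgr_dist_lt.
Unshelve. all: by end_near. Qed.

Lemma cvg_line z v t0 : (z + t%:C *: v) @[t --> t0] --> z + t0%:C *: v.
Proof. by apply: cvgD; [exact: cvg_cst|apply: cvgZr_tmp; exact: cvg_real_complex]. Qed.

Lemma continuous_plane (g : E -> R) u v z e : {for z, continuous g} -> 0 < e ->
  exists2 d : R, 0 < d & forall s t, `|s| < d -> `|t| < d ->
    `|g (z + s%:C *: u + t%:C *: v) - g z| < e.
Proof.
move=> cg e0.
have cp : (z + p.1%:C *: u + p.2%:C *: v) @[p --> ((0 : R), (0 : R))] --> z.
  rewrite [X in _ --> X](_ : z = z + (0 : R)%:C *: u + (0 : R)%:C *: v); last first.
    by rewrite !scale0r !addr0.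
  apply: cvgD; first apply: cvgD; first exact: cvg_cst.
    apply: cvgZr_tmp; apply: (cvg_comp _ _ (@cvg_fst _ _ _ _ _)).
    exact: cvg_real_complex.
  apply: cvgZr_tmp; apply: (cvg_comp _ _ (@cvg_snd _ _ _ _ _)).
  exact: cvg_real_complex.
have /cvgrPdist_lt /(_ e e0) : g (z + p.1%:C *: u + p.2%:C *: v) @[p --> ((0 : R), (0 : R))] --> g z.
  exact: (cvg_comp _ _ cp).
move=> /nbhs_ballP[d d0 H]; exists d => // s t sd td.
rewrite distrC; apply: (H (s, t)); split; by rewrite /ball/= sub0r normrN.
Qed.

Lemma rd_continuous_line v f (g : E -> R) z : (forall z, rd v f z (g z)) ->
  continuous (fun t : R => f (z + t%:C *: v)).
Proof.
move=> df t; apply: differentiable_continuous; apply/derivable1_diffP.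
by case: (rd_line (df (z + t%:C *: v))).
Qed.

Lemma rd_MVT v f (g : E -> R) : (forall z, rd v f z (g z)) ->
  forall z h, exists2 t, `|t| <= `|h| &
    f (z + h%:C *: v) - f z = g (z + t%:C *: v) * h.
Proof.
move=> df z h.
have dl (t : R) : is_derive t 1 (fun t : R => f (z + t%:C *: v)) (g (z + t%:C *: v)).
  exact: rd_line.
have cl (a b : R) : {within `[a, b], continuous (fun t : R => f (z + t%:C *: v))}.
  by apply: continuous_subspaceT; exact: rd_continuous_line df.
have [h0|h0] := leP 0 h.
- have [c] := MVT_segment h0 (fun t _ => dl t) (cl _ _).
  rewrite in_itv/= => /andP[c0 ch]; rewrite scale0r addr0 subr0 => ->.
  by exists c => //; rewrite !ger0_norm.
- have [c] := MVT_segment (ltW h0) (fun t _ => dl t) (cl _ _).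
  rewrite in_itv/= => /andP[hc c0]; rewrite scale0r addr0 sub0r mulrN => H.
  exists c; first by rewrite !ler0_norm ?lerN2// ltW.
  by rewrite -[RHS]opprK -H opprB.
Qed.

(** Move along [u] first and then along [v]. The mean value theorem turns the second increment into
    a value of [g] near [z], so continuity of the derivative along [v] at that one point
    suffices. *)
Lemma rd_add u v f (g : E -> R) z a : rd u f z a -> (forall z, rd v f z (g z)) ->
  {for z, continuous g} -> rd (u + v) f z (a + g z).
Proof.
move=> /is_derive1P du dv cg; apply/is_derive1P => e e0.
have e20 : 0 < e / 2 by rewrite divr_gt0.
have [d1 d10 H1] := du _ e20.
have [d2 d20 H2] := continuous_plane u v cg e20.
exists (Num.min d1 d2); first by rewrite lt_min d10.
move=> h; rewrite lt_min => /andP[h1 h2].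
rewrite add0r scale0r addr0.
have := H1 _ h1; rewrite add0r scale0r addr0 => {}H1.
have [t th E1] := rd_MVT dv (z + h%:C *: u) h.
have {}H2 := H2 h t h2 (le_lt_trans th h2).
rewrite scalerDr addrA.
rewrite (_ : _ - _ - _ = (f (z + h%:C *: u) - f z - h * a) +
  (g (z + h%:C *: u + t%:C *: v) - g z) * h); last first.
  by move: E1 => /(canRL (subrK _)) ->; ring.
rewrite (le_trans (ler_normD _ _))// normrM (splitr e) mulrDl lerD//.
by rewrite ler_wpM2r// ltW.
Qed.

Lemma rd_scale v f z l (c : R) : rd v f z l -> rd (c%:C *: v) f z (c * l).
Proof.
move=> df; rewrite /rd.
have -> : (fun t : R => f (z + t%:C *: (c%:C *: v))) =
  (fun t : R => f (z + t%:C *: v)) \o ( *%R c).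
  by apply/funext => t /=; rewrite scalerA -rmorphM/= mulrC.
rewrite mulrC; apply: is_derive1_comp; first by rewrite mulr0.
have -> : ( *%R c) = (fun t : R => c *: t) by [].
  by apply: is_derive_eq; exact: mulr1.
Qed.

(** The second difference over a parallelogram of side [h] equals [h^2] times either mixed
    derivative at some nearby point, by two mean values taken in either order. Continuity at [z]
    then identifies the two. *)
Lemma rd_schwarz u v f (fu fv fuv fvu : E -> R) z :
  (forall z, rd u f z (fu z)) -> (forall z, rd v f z (fv z)) ->
  (forall z, rd u fv z (fuv z)) -> (forall z, rd v fu z (fvu z)) ->
  {for z, continuous fuv} -> {for z, continuous fvu} -> fuv z = fvu z.
Proof.
move=> du dv duv dvu cuv cvu.
apply/eqP; rewrite -subr_eq0 -normr_le0; apply/ler_addgt0Pl => e e0; rewrite addr0.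
have e20 : 0 < e / 2 by rewrite divr_gt0.
have [d1 d10 H1] := continuous_plane u v cuv e20.
have [d2 d20 H2] := continuous_plane u v cvu e20.
pose h := Num.min d1 d2 / 2.
have h0 : 0 < h by rewrite divr_gt0// lt_min d10.
have hn : `|h| = h by rewrite gtr0_norm.
have m0 : 0 < Num.min d1 d2 by rewrite lt_min d10.
have hm : h < Num.min d1 d2 by rewrite /h; lra.
have [hd1 hd2] : h < d1 /\ h < d2 by move: hm; rewrite lt_min => /andP.
have sub_rd w (F G : E -> R) q : (forall z, rd w F z (G z)) ->
    forall y, rd w (fun x => F (x + q) - F x) y (G (y + q) - G y).
  move=> dF y; apply: is_deriveB; last exact: dF.
  have := dF (y + q); rewrite /rd.
  by under eq_fun do rewrite addrAC.
have [s sh Es] := rd_MVT (sub_rd u f fu (h%:C *: v) du) z h.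
have [t th Et] := rd_MVT dvu (z + s%:C *: u) h.
have [t' th' Et'] := rd_MVT (sub_rd v f fv (h%:C *: u) dv) z h.
have [s' sh' Es'] := rd_MVT duv (z + t'%:C *: v) h.
have E3 : fvu (z + s%:C *: u + t%:C *: v) * h * h =
    fuv (z + s'%:C *: u + t'%:C *: v) * h * h.
  rewrite -Et -Es [z + s'%:C *: u + _]addrAC -Es' -Et'.
  by rewrite (addrAC z); ring.
have E4 : fvu (z + s%:C *: u + t%:C *: v) = fuv (z + s'%:C *: u + t'%:C *: v).
  by move: E3 => /(mulIf (lt0r_neq0 h0)) /(mulIf (lt0r_neq0 h0)).
rewrite hn in sh th sh' th'.
have := H1 s' t' (le_lt_trans sh' hd1) (le_lt_trans th' hd1).
have := H2 s t (le_lt_trans sh hd2) (le_lt_trans th hd2).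
rewrite E4; set w := fuv (_ + _ + _) => A B.
rewrite (_ : _ - _ = (w - fvu z) - (w - fuv z)); last by ring.
by rewrite (splitr e) (le_trans (ler_normB _ _))// lerD// ltW.
Qed.

End LineCalculus.

(** * Linearity and symmetry of iterated directional derivatives *)

Section SmoothHessian.
Context {R : realType} {E : normedModType R[i]}.
Implicit Types (f : E -> R) (u v z : E).

Lemma smooth_rd f vs v z : smooth f ->
  rd v (rderives vs f) z (rderives (v :: vs) f z).
Proof. by move=> sf; apply: rdP; case: (sf vs). Qed.

Lemma smooth_rderiveD f vs u v z : smooth f ->
  rderives (u + v :: vs) f z = rderives (u :: vs) f z + rderives (v :: vs) f z.
Proof.
move=> sf; apply: rdE; apply: rd_add; first exact: smooth_rd.
  by move=> y; exact: smooth_rd.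
by case: (sf (v :: vs)) => + _; exact.
Qed.

Lemma smooth_rderiveZ f vs (c : R) v z : smooth f ->
  rderives (c%:C *: v :: vs) f z = c * rderives (v :: vs) f z.
Proof. by move=> sf; apply: rdE; apply: rd_scale; exact: smooth_rd. Qed.

Lemma smooth_rderiveC f u v z : smooth f ->
  rderives [:: u; v] f z = rderives [:: v; u] f z.
Proof.
move=> sf; apply: (@rd_schwarz _ _ u v f) => [y|y|y|y||].
- exact: (smooth_rd [::]).
- exact: (smooth_rd [::]).
- exact: (smooth_rd [:: v]).
- exact: (smooth_rd [:: u]).
- by case: (sf [:: u; v]) => + _; exact.
- by case: (sf [:: v; u]) => + _; exact.
Qed.

Lemma smooth_rderive0 f vs z : smooth f -> rderives (0 :: vs) f z = 0.
Proof. by move=> sf; rewrite -(scale0r 0) (smooth_rderiveZ vs 0 0 z sf) mul0r. Qed.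

Lemma smooth_rderive_sum f vs (I : Type) (r : seq I) (c : I -> R) (F : I -> E) z :
  smooth f -> rderives (\sum_(i <- r) (c i)%:C *: F i :: vs) f z =
  \sum_(i <- r) c i * rderives (F i :: vs) f z.
Proof.
move=> sf; elim: r => [|i r IH]; first by rewrite !big_nil smooth_rderive0.
by rewrite !big_cons smooth_rderiveD// smooth_rderiveZ// IH.
Qed.

End SmoothHessian.

(** * The Levi form *)

Section Levi.
Context {R : realType} {n : nat}.
Local Notation Cn := 'rV[R[i]]_n.
Implicit Types (f : Cn -> R) (P w : Cn).

Lemma row_real_basis w : w =
  \sum_j (complex.Re (w 0 j))%:C *: basis_vec j +
  \sum_j (complex.Im (w 0 j))%:C *: ('i *: basis_vec j).
Proof.
rewrite -big_split/= {1}(row_sum_delta w); apply: eq_bigr => j _.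
by rewrite scalerA -scalerDl; congr (_ *: _); rewrite {1}[w 0 j]complexE mulrC.
Qed.

Lemma smooth_rderive_row f vs w z : smooth f -> rderives (w :: vs) f z =
  \sum_j (complex.Re (w 0 j) * rderives (basis_vec j :: vs) f z +
          complex.Im (w 0 j) * rderives ('i *: basis_vec j :: vs) f z).
Proof.
by move=> sf; rewrite {1}(row_real_basis w) smooth_rderiveD// !smooth_rderive_sum// big_split.
Qed.

Lemma rderive_halfr (f : Cn -> R) v P : rderivable v f P ->
  rderive v (fun z => 2^-1 * f z) P = 2^-1 * rderive v f P.
Proof.
move=> /rdP df; apply: rdE.
exact: (@is_deriveZ _ _ _ (fun t : R => f (P + t%:C *: v)) 2^-1 _ _ _ df).
Qed.

Lemma rderive_cst (c : R) v P : rderive v (fun=> c) P = 0.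
Proof. by rewrite /rderive derive1_cst. Qed.

Lemma d_z_d_zbar f j k P : smooth f ->
  d_z j (d_zbar k (fun x => (f x)%:C)) P =
  (4^-1 * (rderives [:: basis_vec j; basis_vec k] f P +
           rderives [:: 'i *: basis_vec j; 'i *: basis_vec k] f P)) +i*
  (4^-1 * (rderives [:: basis_vec j; 'i *: basis_vec k] f P -
           rderives [:: 'i *: basis_vec j; basis_vec k] f P)).
Proof.
move=> sf /=.
have -> : d_zbar k (fun x => (f x)%:C) = fun z : Cn =>
    (2^-1 * rderive (basis_vec k) f z) +i* (2^-1 * rderive ('i *: basis_vec k) f z).
  apply/funext => z; rewrite /d_zbar /cderive/= !rderive_cst.
  rewrite (_ : (2^-1 : R[i]) = (2^-1 : R)%:C); last by rewrite fmorphV rmorph_nat.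
  by simpc; congr (_ +i* _); ring.
have sd u v : rderivable u (rderive v f) P by case: (sf [:: v]).
move: (sd) => /(_ _ (basis_vec k)) dg; move: (sd) => /(_ _ ('i *: basis_vec k)) dh.
move: (rderive (basis_vec k) f) (rderive ('i *: basis_vec k) f) dg dh => g h dg dh.
rewrite /d_z /cderive/=.
rewrite (rderive_halfr (dg (basis_vec j))) (rderive_halfr (dh (basis_vec j))).
rewrite (rderive_halfr (dg ('i *: basis_vec j))) (rderive_halfr (dh ('i *: basis_vec j))).
rewrite (_ : (2^-1 : R[i]) = (2^-1 : R)%:C); last by rewrite fmorphV rmorph_nat.
move: (rderive _ g P) (rderive _ h P) (rderive _ g P) (rderive _ h P) => a b c d.
by simpc; congr (_ +i* _); field.
Qed.

(** The right side is a quarter of the Laplacian of [f] along the complex line through [P] in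
    direction [w]. Pseudoconvexity thereby reduces to subharmonicity on complex lines. *)
Lemma levi_formE f P w : smooth f ->
  levi_form f P w =
  (4^-1 * (rderives [:: w; w] f P + rderives [:: 'i *: w; 'i *: w] f P))%:C.
Proof.
move=> sf; rewrite /levi_form.
pose a j := complex.Re (w 0 j); pose b j := complex.Im (w 0 j).
have [e eE] : exists e : 'I_n -> Cn, forall j, basis_vec j = e j by exists (@basis_vec R n).
have [e' e'E] : exists e' : 'I_n -> Cn, forall j, 'i *: basis_vec j = e' j.
  by exists (fun j => 'i *: basis_vec j).
have [H HE] : exists H, forall u v, rderives [:: u; v] f P = H u v by eexists.
have HC u v : H u v = H v u by rewrite -!HE; exact: smooth_rderiveC.
have Hrow x u : H x u = \sum_j (complex.Re (x 0 j) * H (e j) u + complex.Im (x 0 j) * H (e' j) u).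
  rewrite -HE smooth_rderive_row//; apply: eq_bigr => j _.
  by rewrite -e'E -eE -!HE.
pose A j k := 4^-1 * (H (e j) (e k) + H (e' j) (e' k)).
pose B j k := 4^-1 * (H (e j) (e' k) - H (e' j) (e k)).
transitivity (\sum_j \sum_k ((A j k * (a j * a k + b j * b k) -
    B j k * (b j * a k - a j * b k)) +i*
    (A j k * (b j * a k - a j * b k) + B j k * (a j * a k + b j * b k)))).
  apply: eq_bigr => j _; apply: eq_bigr => k _; rewrite d_z_d_zbar//.
  rewrite !HE !e'E !eE /A /B /a /b.
  move: (H _ _) (H _ _) (H _ _) (H _ _) => x1 x2 x3 x4.
  case: (w 0 j) => aj bj; case: (w 0 k) => ak bk /=.
  by rewrite /Num.conj/=; simpc; congr (_ +i* _); ring.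
have expand x : rderives [:: x; x] f P = \sum_j \sum_k
    (complex.Re (x 0 j) * complex.Re (x 0 k) * H (e j) (e k) +
     complex.Re (x 0 j) * complex.Im (x 0 k) * H (e j) (e' k) +
     complex.Im (x 0 j) * complex.Re (x 0 k) * H (e' j) (e k) +
     complex.Im (x 0 j) * complex.Im (x 0 k) * H (e' j) (e' k)).
  rewrite HE Hrow; apply: eq_bigr => j _.
  rewrite HC [H _ x]HC !Hrow !mulr_sumr -big_split/=; apply: eq_bigr => k _.
  rewrite !(HC _ (e j)) !(HC _ (e' j)).
  move: (H _ _) (H _ _) (H _ _) (H _ _) => x1 x2 x3 x4.
  by ring.
rewrite !expand -big_split/= mulr_sumr.
have Re_sum (F : 'I_n -> R[i]) : complex.Re (\sum_j F j) = \sum_j complex.Re (F j).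
  exact: (raddf_sum (@complex.Re R)).
have Im_sum (F : 'I_n -> R[i]) : complex.Im (\sum_j F j) = \sum_j complex.Im (F j).
  exact: (raddf_sum (@complex.Im R)).
apply/eqP; rewrite eq_complex/= Re_sum Im_sum; apply/andP; split; apply/eqP.
- apply: eq_bigr => j _; rewrite Re_sum -big_split/= mulr_sumr.
  apply: eq_bigr => k _ /=; rewrite !mxE /A /B /a /b.
  move: (H _ _) (H _ _) (H _ _) (H _ _) => x1 x2 x3 x4.
  by case: (w 0 j) (w 0 k) => aj bj [ak bk]/=; ring.
(* Exchanging [j] and [k] negates every term, by symmetry of the real Hessian; so the imaginary part
   is its own opposite. *)
- set S := (LHS).
  have S2 : S = - S.
    rewrite {1}/S; under eq_bigr do rewrite Im_sum.
    rewrite exchange_big/= /S -sumrN; apply: eq_bigr => j _.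
    rewrite Im_sum -sumrN; apply: eq_bigr => k _ /=.
    rewrite /A /B (HC (e k) (e j)) (HC (e' k) (e' j)) (HC (e k)) (HC (e' k)).
    move: (H _ _) (H _ _) (H _ _) (H _ _) => x1 x2 x3 x4.
    by ring.
  by move: S2; lra.
Qed.

End Levi.

(** * Families with uniformly bounded derivatives *)

Section UniformlySmooth.
Context {R : realType} {E : normedModType R[i]}.
Implicit Types (f g : E -> R) (u v z : E) (FF GG : set (E -> R)) (M V : R).

Definition derived V FF : set (E -> R) :=
  [set g | exists v f, [/\ `|v| <= V%:C, FF f & g = rderive v f]].

(* Working with families gives bounds on iterated derivatives that are uniform in
   the directions of differentiation, which the choice of weights of the potential
   requires. *)
Fixpoint Ck_family k FF : Prop :=
  [/\ forall f, FF f -> continuous f,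
      forall M, exists B : R, forall f z, FF f -> `|z| <= M%:C -> `|f z| <= B &
      if k is k'.+1 then
        (forall f v z, FF f -> rderivable v f z) /\
        forall V, Ck_family k' (derived V FF)
      else True].

Definition lift2 (op : R -> R -> R) FF GG : set (E -> R) :=
  [set h | exists f g, [/\ FF f, GG g & h = fun z => op (f z) (g z)]].

Lemma Ck_family_continuous k FF f : Ck_family k FF -> FF f -> continuous f.
Proof. by case: k => [|k] [+ _ _]; exact. Qed.

Lemma Ck_family_bound k FF M : Ck_family k FF ->
  exists B : R, forall f z, FF f -> `|z| <= M%:C -> `|f z| <= B.
Proof. by case: k => [|k] [_ + _]; exact. Qed.

Lemma Ck_family_rderivable k FF f v z : Ck_family k.+1 FF -> FF f -> rderivable v f z.
Proof. by case=> _ _ [+ _]; exact. Qed.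

Lemma Ck_family_derived k FF V : Ck_family k.+1 FF -> Ck_family k (derived V FF).
Proof. by case=> _ _ [_ +]; exact. Qed.

Lemma derived_sub V FF GG : FF `<=` GG -> derived V FF `<=` derived V GG.
Proof. by move=> FG g [v [f [vV Ff ->]]]; exists v, f; split=> //; exact: FG. Qed.

Lemma Ck_family_sub k FF GG : FF `<=` GG -> Ck_family k GG -> Ck_family k FF.
Proof.
elim: k FF GG => [|k IH] FF GG FG.
  case=> c b _; split=> // [f /FG/c//|M].
  by have [B HB] := b M; exists B => f z /FG; exact: HB.
case=> c b [d D]; split=> [f /FG/c//|M|].
  by have [B HB] := b M; exists B => f z /FG; exact: HB.
by split=> [f v z /FG/d//|V]; exact: (IH _ _ (derived_sub FG) (D V)).
Qed.

Lemma Ck_family_pred k FF : Ck_family k.+1 FF -> Ck_family k FF.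
Proof.
elim: k FF => [|k IH] FF; case=> c b [d D]; split=> //; split=> // V.
exact: IH.
Qed.

Lemma Ck_family_op2 (op : R -> R -> R) k FF GG :
  (forall f g, FF f -> GG g -> continuous (fun z => op (f z) (g z))) ->
  (forall A B, exists C, forall a b, `|a| <= A -> `|b| <= B -> `|op a b| <= C) ->
  Ck_family 0 FF -> Ck_family 0 GG ->
  (if k is k'.+1 then (forall f g v z, FF f -> GG g -> rderivable v (fun z => op (f z) (g z)) z) /\
     forall V, Ck_family k' (derived V (lift2 op FF GG)) else True) ->
  Ck_family k (lift2 op FF GG).
Proof.
move=> cop bop uF uG H.
have c : forall f, lift2 op FF GG f -> continuous f.
  by move=> h [f [g [Ff Gg ->]]]; exact: cop.
have b M : exists B : R, forall f z, lift2 op FF GG f -> `|z| <= M%:C -> `|f z| <= B.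
  have [A HA] := Ck_family_bound M uF; have [B HB] := Ck_family_bound M uG.
  have [C HC] := bop A B; exists C => _ z [f [g [Ff Gg ->]]] zM.
  by apply: HC; [exact: HA|exact: HB].
case: k H => [|k] H; split=> //; case: H => H1 H2; split=> // _ v z [f [g [Ff Gg ->]]].
exact: H1.
Qed.

Lemma Ck_family_add k FF GG : Ck_family k FF -> Ck_family k GG -> Ck_family k (lift2 +%R FF GG).
Proof.
have cadd f g : continuous f -> continuous g -> continuous (fun z => f z + g z).
  by move=> cf cg z; apply: cvgD; [exact: cf|exact: cg].
have badd A B : exists C, forall a b, `|a| <= A -> `|b| <= B -> `|a + b| <= C :> R.
  by exists (A + B) => a b aA bB; rewrite (le_trans (ler_normD _ _))// lerD.
elim: k FF GG => [|k IH] FF GG uF uG; apply: Ck_family_op2 => //; do ?exact: (Ck_family_continuous (k := 0));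
  do ?[by move=> f g Ff Gg; apply: cadd; [exact: Ck_family_continuous uF Ff|exact: Ck_family_continuous uG Gg]].
- by case: uF => ? ? _; split.
- by case: uG => ? ? _; split.
have dadd f g v z : FF f -> GG g -> rd v (fun z => f z + g z) z (rderive v f z + rderive v g z).
  move=> Ff Gg; apply: is_deriveD; apply: rdP; [exact: Ck_family_rderivable uF Ff|exact: Ck_family_rderivable uG Gg].
split=> [f g v z Ff Gg|V]; first exact: rd_derivable (dadd f g v z Ff Gg).
apply: Ck_family_sub (IH _ _ (Ck_family_derived V uF) (Ck_family_derived V uG)).
move=> _ [v [_ [vV [f [g [Ff Gg ->]]] ->]]]; exists (rderive v f), (rderive v g).
split; [by exists v, f|by exists v, g|].
by apply/funext => z; exact/rdE/dadd.
Qed.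

Lemma Ck_family_mul k FF GG : Ck_family k FF -> Ck_family k GG -> Ck_family k (lift2 *%R FF GG).
Proof.
have cmul f g : continuous f -> continuous g -> continuous (fun z => f z * g z).
  by move=> cf cg z; apply: cvgM; [exact: cf|exact: cg].
have bmul A B : exists C, forall a b, `|a| <= A -> `|b| <= B -> `|a * b| <= C :> R.
  by exists (A * B) => a b aA bB; rewrite normrM ler_pM.
elim: k FF GG => [|k IH] FF GG uF uG; apply: Ck_family_op2 => //; do ?exact: (Ck_family_continuous (k := 0));
  do ?[by move=> f g Ff Gg; apply: cmul; [exact: Ck_family_continuous uF Ff|exact: Ck_family_continuous uG Gg]].
- by case: uF => ? ? _; split.
- by case: uG => ? ? _; split.
have dmul f g v z : FF f -> GG g ->
    rd v (fun z => f z * g z) z (f z * rderive v g z + g z * rderive v f z).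
  move=> Ff Gg; have := is_deriveM (rdP (Ck_family_rderivable (v := v) (z := z) uF Ff)) (rdP (Ck_family_rderivable (v := v) (z := z) uG Gg)).
  by rewrite scale0r addr0.
split=> [f g v z Ff Gg|V]; first exact: rd_derivable (dmul f g v z Ff Gg).
apply: Ck_family_sub (Ck_family_add (IH _ _ (Ck_family_pred uF) (Ck_family_derived V uG)) (IH _ _ (Ck_family_pred uG) (Ck_family_derived V uF))).
move=> _ [v [_ [vV [f [g [Ff Gg ->]]] ->]]].
exists (fun z => f z * rderive v g z), (fun z => g z * rderive v f z); split.
- by exists f, (rderive v g); split=> //; exists v, g.
- by exists g, (rderive v f); split=> //; exists v, f.
- by apply/funext => z; exact/rdE/dmul.
Qed.

Lemma Ck_family_cst k C : Ck_family k [set f | exists2 c : R, `|c| <= C & f = fun=> c].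
Proof.
elim: k C => [|k IH] C; split=> //.
- by move=> _ [c _ ->] z; exact: cvg_cst.
- by move=> M; exists C => _ z [c cC ->].
- by move=> _ [c _ ->] z; exact: cvg_cst.
- by move=> M; exists C => _ z [c cC ->].
split=> [_ v z [c _ ->]|V]; first exact: derivable_cst.
apply: Ck_family_sub (IH 0) => _ [v [_ [_ [c _ ->] ->]]]; exists 0; rewrite ?normr0//.
by apply/funext => z; rewrite /rderive derive1_cst.
Qed.

Lemma Ck_family_linear k (L : E -> R) C : continuous L -> {morph L : u v / u + v} ->
  (forall (c : R) v, L (c%:C *: v) = c * L v) ->
  (forall M z, `|z| <= M%:C -> `|L z| <= C * M) ->
  Ck_family k [set L].
Proof.
move=> cL LD LZ LC.
have dL v z : rd v L z (L v).
  apply/is_derive1P => e e0; exists 1 => // h _.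
  rewrite add0r scale0r addr0 LD LZ (_ : _ - _ - _ = 0); last by ring.
  by rewrite normr0 mulr_ge0// ltW.
have c f : [set L] f -> continuous f by move=> ->.
have b M : exists B : R, forall f z, [set L] f -> `|z| <= M%:C -> `|f z| <= B.
  by exists (C * M) => _ z -> /LC.
case: k => [|k]; split=> //; split=> [_ v z ->|V]; first exact: rd_derivable (dL v z).
apply: Ck_family_sub (Ck_family_cst k (C * V)) => _ [v [_ [vV -> ->]]]; exists (L v); first exact: LC.
by apply/funext => z; exact/rdE/dL.
Qed.

(** [phi] lists the successive derivatives of one function, and all [i] are treated together because
    differentiating the composite leads to [phi i.+1]. The set [D] makes room for [ln] on a
    half-line away from 0. *)
Lemma Ck_family_comp k FF (D : set R) (phi : nat -> R -> R) :
  (forall i x, D x -> is_derive x 1 (phi i) (phi i.+1 x)) ->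
  (forall i B, exists C, forall x, D x -> `|x| <= B -> `|phi i x| <= C) ->
  (forall f z, FF f -> D (f z)) ->
  Ck_family k FF -> forall i, Ck_family k [set g | exists2 f, FF f & g = phi i \o f].
Proof.
move=> dphi bphi FD; elim: k => [|k IH] uF i.
all: have c g : [set g | exists2 f, FF f & g = phi i \o f] g -> continuous g.
1,3: move=> [f Ff ->] z; apply: continuous_comp; [exact: Ck_family_continuous uF Ff z|].
1,2: by apply/differentiable_continuous/derivable1_diffP; case: (dphi i _ (FD f z Ff)).
all: have b M : exists B : R, forall g z, [set g | exists2 f, FF f & g = phi i \o f] g ->
    `|z| <= M%:C -> `|g z| <= B.
1,3: have [A HA] := Ck_family_bound M uF; have [B HB] := bphi i A.
1,2: by exists B => _ z [f Ff ->] zM; apply: HB; [exact: FD|exact: HA].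
  by split.
have dcomp f v z : FF f -> rd v (phi i \o f) z (phi i.+1 (f z) * rderive v f z).
  move=> Ff; apply: is_derive1_comp; last exact/rdP/(Ck_family_rderivable uF Ff).
  by rewrite scale0r addr0; apply: dphi; exact: FD.
split=> //; split=> [_ v z [f Ff ->]|V]; first exact: rd_derivable (dcomp f v z Ff).
apply: Ck_family_sub (Ck_family_mul (IH (Ck_family_pred uF) i.+1) (Ck_family_derived V uF)).
move=> _ [v [_ [vV [f Ff ->] ->]]]; exists (phi i.+1 \o f), (rderive v f); split.
- by exists f.
- by exists v, f.
- by apply/funext => z; exact/rdE/dcomp.
Qed.

Lemma Ck_family_derived_iter FF : (forall k, Ck_family k FF) -> forall vs f, FF f ->
  exists2 GG, (forall k, Ck_family k GG) & GG (rderives vs f).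
Proof.
move=> uF; elim=> [|v vs IH] f Ff; first by exists FF.
have [GG uG Gf] := IH f Ff.
have vn : `|v| <= (complex.Re `|v|)%:C.
  by have := normr_ge0 v; rewrite !lecE/= lexx => /andP[/eqP -> _]; rewrite eqxx.
exists (derived (complex.Re `|v|) GG) => [k|]; first exact: Ck_family_derived (uG k.+1).
by exists v, (rderives vs f).
Qed.

Lemma Ck_family_smooth FF f : (forall k, Ck_family k FF) -> FF f -> smooth f.
Proof.
move=> uF Ff vs; have [GG uG Gf] := Ck_family_derived_iter uF vs Ff.
split; first exact: Ck_family_continuous (uG 0) Gf.
by move=> v z; exact: Ck_family_rderivable (uG 1) Gf.
Qed.

Lemma Ck_family_rderives_bound FF j V M : Ck_family j FF ->
  exists B : R, forall f vs z, FF f -> (size vs <= j)%N ->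
    (forall v, List.In v vs -> `|v| <= V%:C) -> `|z| <= M%:C ->
    `|rderives vs f z| <= B.
Proof.
elim: j FF => [|j IH] FF uF.
  have [B HB] := Ck_family_bound M uF; exists B => f [|//] z Ff _ _ zM; exact: HB.
have [B HB] := Ck_family_bound M uF; have [B' HB'] := IH _ (Ck_family_derived V uF).
exists (Num.max B B') => f vs z Ff; case/lastP: vs => [|vs v] sv vV zM.
  (* The last direction of a nonempty list is differentiated first, which is exactly the derivative
     that [derived] absorbs. *)
  by rewrite le_max HB.
have -> : rderives (rcons vs v) f = rderives vs (rderive v f) by exact: foldr_rcons.
rewrite le_max; apply/orP; right; apply: (HB' (rderive v f) vs) => //.
- by exists v, f; split=> //; apply: vV; rewrite -cats1; apply/List.in_or_app; right; left.
- by move: sv; rewrite size_rcons.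
- by move=> w wv; apply: vV; rewrite -cats1; apply/List.in_or_app; left.
Qed.

End UniformlySmooth.

(** * Series of smooth functions *)

Section GeometricTail.
Context {R : realType}.
Implicit Types (u : R ^nat) (c : R).

Lemma half_expn_gt0 n : 0 < (2^-1 : R) ^+ n.
Proof. by rewrite exprn_gt0. Qed.

Lemma half_expn_small c (e : R) : 0 < e ->
  exists N, forall n, (N <= n)%N -> c * 2^-1 ^+ n < e.
Proof.
move=> e0; have : c * (2^-1 : R) ^+ n @[n --> \oo] --> c * 0.
  by apply: cvgMr; apply: cvg_expr; rewrite ger0_norm//; lra.
rewrite mulr0 => /cvgrPdist_lt /(_ _ e0) [N _ HN].
exists N => n Nn; have := HN n Nn; rewrite /= sub0r normrN.
exact/le_lt_trans/ler_norm.
Qed.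

Lemma tail_sum_le u c N n m : 0 <= c ->
  (forall k, (N <= k)%N -> `|u k| <= c * 2^-1 ^+ k) ->
  (N <= n)%N -> (n <= m)%N -> `|series u m - series u n| <= c * 2 * 2^-1 ^+ n.
Proof.
(* Subtracting the part of the geometric tail not yet used makes the induction on [m] close. *)
move=> c0 uN Nn nm; suff : `|series u m - series u n| <= c * 2 * 2^-1 ^+ n - c * 2 * 2^-1 ^+ m.
  by move=> /le_trans; apply; rewrite gerBl !mulr_ge0// ltW// half_expn_gt0.
elim: m nm => [|m IH]; first by rewrite leqn0 => /eqP ->; rewrite !subrr normr0.
rewrite leq_eqVlt => /orP[/eqP ->|]; first by rewrite !subrr normr0.
rewrite ltnS => nm; have := IH nm; have := uN m (leq_trans Nn nm).
have -> : series u m.+1 - series u n = (series u m - series u n) + u m.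
  by rewrite -(seriesSB u m); ring.
move=> H1 H2; rewrite (le_trans (ler_normD _ _))//.
have -> : c * 2 * 2^-1 ^+ m.+1 = c * 2^-1 ^+ m by rewrite exprS; field.
by lra.
Qed.

Lemma is_cvg_series_tail u c N : 0 <= c ->
  (forall k, (N <= k)%N -> `|u k| <= c * 2^-1 ^+ k) -> cvgn (series u).
Proof.
move=> c0 uN; apply: cauchy_cvg; apply/cauchy_seriesP => e e0.
have [M HM] := half_expn_small (c * 2) e0.
have le m n : (maxn M N <= m)%N -> (m <= n)%N -> `|\sum_(m <= k < n) u k| < e.
  move=> Mm mn; rewrite -sub_series_geq//.
  apply: le_lt_trans (HM m (leq_trans (leq_maxl M N) Mm)).
  exact: tail_sum_le (leq_trans (leq_maxr M N) Mm) mn.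
exists ([set m | (maxn M N <= m)%N], [set m | (maxn M N <= m)%N]) => /=.
  by split; exists (maxn M N).
move=> [m n]/= [mM nM]; have [mn|/ltnW nm] := leqP m n; first exact: le.
by rewrite big_geq// normr0.
Qed.

Lemma series_tail_le u c N n : 0 <= c ->
  (forall k, (N <= k)%N -> `|u k| <= c * 2^-1 ^+ k) ->
  (N <= n)%N -> `|limn (series u) - series u n| <= c * 2 * 2^-1 ^+ n.
Proof.
move=> c0 uN Nn; have cu := is_cvg_series_tail c0 uN.
have cd : (fun m => series u m - series u n) @ \oo --> limn (series u) - series u n.
  by apply: cvgB => //; exact: cvg_cst.
rewrite -(cvg_lim _ (cvg_norm cd))//.
apply: limr_le; first by apply/cvg_ex; eexists; exact: cvg_norm cd.
by exists n => // m nm; exact: tail_sum_le c0 uN Nn nm.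
Qed.

End GeometricTail.

Section UniformSeries.
Context {R : realType} {E : normedModType R[i]}.
Implicit Types (f : E -> R) (g : nat -> E -> R) (GG : set (nat -> E -> R)) (u v z : E).

Definition fseries g : E -> R := fun z => limn (series (g^~ z)).

(** The threshold [N] may depend on the radius [M] but not on the member of the family: early terms
    may be large, and the convergence is locally uniform. *)
Definition decays GG := forall M : R, exists N, forall n g z,
  (N <= n)%N -> GG g -> `|z| <= M%:C -> `|g n z| <= 2^-1 ^+ n.

Definition derived_seq (V : R) GG : set (nat -> E -> R) :=
  [set h | exists v g, [/\ `|v| <= V%:C, GG g & h = fun n => rderive v (g n)]].

Fixpoint smoothly_decays k GG := decays GG /\
  if k is k'.+1 then forall V, smoothly_decays k' (derived_seq V GG) else True.

Lemma norm_realE v : `|v| = (complex.Re `|v|)%:C.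
Proof.
have := normr_ge0 v; rewrite lecE/= => /andP[/eqP h _].
by apply/eqP; rewrite eq_complex/= h !eqxx.
Qed.

Lemma norm_near v : \forall z \near v, `|z| <= (complex.Re `|v| + 1)%:C.
Proof.
near=> z; rewrite rmorphD/= -norm_realE -lerBlDl.
apply: (le_trans (lerB_dist _ _)); rewrite distrC; near: z.
by apply: cvgr_dist_le.
Unshelve. all: by end_near. Qed.

Lemma decays_cvg GG g z : decays GG -> GG g -> cvgn (series (g^~ z)).
Proof.
move=> dG Gg; have [N HN] := dG (complex.Re `|z|).
apply: (@is_cvg_series_tail _ _ 1 N) => // k Nk.
by rewrite mul1r; apply: HN; rewrite // -norm_realE.
Qed.

Lemma fseries_partial_le GG M : decays GG -> exists N, forall n g z,
  (N <= n)%N -> GG g -> `|z| <= M%:C ->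
  `|fseries g z - series (g^~ z) n| <= 2 * 2^-1 ^+ n.
Proof.
move=> /(_ M)[N HN]; exists N => n g z Nn Gg zM.
rewrite -[X in _ <= X * _](mul1r 2); apply: series_tail_le Nn => // k Nk.
by rewrite mul1r; exact: HN.
Qed.

Lemma continuous_partial g n : (forall k, continuous (g k)) ->
  continuous (fun z => series (g^~ z) n).
Proof.
move=> cg z; rewrite /series/=; elim: n => [|n IH].
  by under eq_fun do rewrite big_geq//; exact: cvg_cst.
under eq_fun do rewrite big_nat_recr//=.
by apply: cvgD => //; exact: cg.
Qed.

Lemma rd_partial v g (D : nat -> E -> R) n z : (forall k, rd v (g k) z (D k z)) ->
  rd v (fun z => series (g^~ z) n) z (series (D^~ z) n).
Proof.
move=> dg; rewrite /rd /series/=; elim: n => [|n IH].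
  by under eq_fun do rewrite big_geq//; rewrite big_geq//; exact: is_derive_cst.
under eq_fun do rewrite big_nat_recr//=.
by rewrite big_nat_recr//=; apply: is_deriveD => //; exact: dg.
Qed.

Lemma fseries_continuous GG g : decays GG -> GG g -> (forall k, continuous (g k)) ->
  continuous (fseries g).
Proof.
move=> dG Gg cg z; apply/cvgrPdist_lt => e e0.
have e30 : 0 < e / 3 by rewrite divr_gt0.
have [N HN] := fseries_partial_le (complex.Re `|z| + 1) dG.
have [N' HN'] := half_expn_small 2 e30.
pose n := maxn N N'.
have n1 : 2 * 2^-1 ^+ n < e / 3 by apply: HN'; exact: leq_maxr.
near=> y.
have yz : `|series (g^~ z) n - series (g^~ y) n| < e / 3.
  by near: y; apply: cvgr_dist_lt => //; exact: continuous_partial.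
have yM : `|y| <= (complex.Re `|z| + 1)%:C by near: y; exact: norm_near.
have zM : `|z| <= (complex.Re `|z| + 1)%:C.
  by rewrite {1}norm_realE lecR lerDl.
have := HN n g y (leq_maxl _ _) Gg yM; have := HN n g z (leq_maxl _ _) Gg zM.
rewrite -/n => H1 H2.
have -> : fseries g z - fseries g y = (fseries g z - series (g^~ z) n) +
   (series (g^~ z) n - series (g^~ y) n) - (fseries g y - series (g^~ y) n) by ring.
have := ler_normB (fseries g z - series (g^~ z) n + (series (g^~ z) n - series (g^~ y) n))
  (fseries g y - series (g^~ y) n).
have := ler_normD (fseries g z - series (g^~ z) n) (series (g^~ z) n - series (g^~ y) n).
move=> H3 H4; apply: (le_lt_trans H4); lra.
Unshelve. all: by end_near. Qed.

(** Term-by-term differentiation with three errors: that of a partial sum, the tail of the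
    derivatives, and the tail of the increments. *)
Lemma rd_fseries GG GG' v g z : decays GG -> GG g ->
  decays GG' -> GG' (fun n => rderive v (g n)) ->
  (forall n z, rderivable v (g n) z) ->
  rd v (fseries g) z (fseries (fun n => rderive v (g n)) z).
Proof.
move=> dG Gg dG' Gg' dg; apply/is_derive1P => e e0.
have e30 : 0 < e / 3 by rewrite divr_gt0.
pose M := complex.Re `|z| + complex.Re `|v|.
have [N HN] := dG' M.
have [N1 HN1] := half_expn_small 2 e30.
pose n := maxn N N1.
have n1 : 2 * 2^-1 ^+ n < e / 3 by apply: HN1; exact: leq_maxr.
have /is_derive1P /(_ _ e30) [d d0 Hd] :=
  @rd_partial v g (fun k => rderive v (g k)) n z (fun k => rdP (dg k z)).
exists (Num.min d 1); first by rewrite lt_min d0/=.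
move=> h; rewrite lt_min => /andP[hd h1]; have := Hd h hd.
rewrite add0r scale0r addr0.
set S := (X in series X n - _); set S0 := (X in _ - series X n - _); set D := (X in _ - h * series X n).
move=> H1.
have zv (t : R) : `|t| <= `|h| -> `|z + t%:C *: v| <= M%:C.
  move=> th; rewrite /M rmorphD/= -!norm_realE (le_trans (ler_normD _ _))// lerD2l normrZ.
  rewrite (_ : `|t%:C| = `|t|%:C); last by rewrite normc_def/= expr0n/= addr0 sqrtr_sqr.
  by rewrite ler_piMl// (_ : 1 = (1 : R)%:C)// lecR (le_trans th)// ltW.
(* The mean value theorem bounds each increment by [|h|] times a derivative, so the decay of the
   derivatives yields the needed factor [|h|]. *)
have H2 : `|limn (series (S - S0)) - series (S - S0) n| <= `|h| * 2 * 2^-1 ^+ n.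
  apply: series_tail_le (leq_maxl N N1) => // k Nk.
  rewrite -[(S - S0) k]/(g k (z + h%:C *: v) - g k z).
  have [t th ->] := rd_MVT (fun y => rdP (dg k y)) z h.
  by rewrite normrM mulrC ler_wpM2l//; apply: (HN k _ _ Nk Gg'); exact: zv.
have H3 : `|limn (series D) - series D n| <= 1 * 2 * 2^-1 ^+ n.
  apply: series_tail_le (leq_maxl N N1) => // k Nk.
  rewrite mul1r; apply: (HN k _ _ Nk Gg'); rewrite -[z]addr0 -(scale0r v).
  by apply: zv; rewrite normr0.
have cS : cvgn (series S) by exact: decays_cvg dG Gg.
have cS0 : cvgn (series S0) by exact: decays_cvg dG Gg.
rewrite lim_seriesB// in H2.
have sB : series (S - S0) n = series S n - series S0 n.
  by rewrite /series/= -sumrB.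
rewrite sB in H2.
rewrite -[fseries g (z + _)]/(limn (series S)) -[fseries g z]/(limn (series S0)) -[fseries _ z]/(limn (series D)).
move: H1 H2 H3.
move: (limn (series S)) (limn (series S0)) (limn (series D)) (series S n) (series S0 n) (series D n) => a b c a' b' c' H1 H2 H3.
have -> : a - b - h * c = (a' - b' - h * c') + (a - b - (a' - b')) - h * (c - c') by ring.
have H4 : `|h * (c - c')| <= `|h| * (e / 3).
  by rewrite normrM ler_wpM2l//; lra.
have H5 : `|a - b - (a' - b')| <= `|h| * (e / 3).
  by apply: le_trans H2 _; rewrite -mulrA ler_wpM2l// ltW.
rewrite (le_trans (ler_normB _ _))//.
have := ler_normD (a' - b' - h * c') (a - b - (a' - b')).
have -> : e * `|h| = e / 3 * `|h| + `|h| * (e / 3) + `|h| * (e / 3) by field.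
by lra.
Qed.

Lemma Ck_family_series0 GG : (forall n, Ck_family 0 [set g n | g in GG]) -> decays GG ->
  Ck_family 0 [set fseries g | g in GG].
Proof.
move=> uG dG; split=> // [_ [g Gg <-]|M].
  by apply: (fseries_continuous dG Gg) => n; apply: (Ck_family_continuous (uG n)); exists g.
have [N HN] := fseries_partial_le M dG.
have [B HB] : exists B : R, forall g z, GG g -> `|z| <= M%:C -> `|series (g^~ z) N| <= B.
  elim: N {HN} => [|N [B HB]]; first by exists 0 => g z _ _; rewrite /series/= big_geq// normr0.
  have [B' HB'] := Ck_family_bound M (uG N); exists (B + B') => g z Gg zM.
  rewrite /series/= big_nat_recr//= (le_trans (ler_normD _ _))// lerD//; first exact: HB.
  by apply: HB' => //; exists g.
exists (B + 2 * 2^-1 ^+ N) => _ z [g Gg <-] zM.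
have := HB g z Gg zM; have := HN N g z (leqnn N) Gg zM => H1 H2.
by rewrite -[fseries g z](subrK (series (g^~ z) N)) (le_trans (ler_normD _ _))//; lra.
Qed.

Lemma Ck_family_series k GG : (forall n, Ck_family k [set g n | g in GG]) -> smoothly_decays k GG ->
  Ck_family k [set fseries g | g in GG].
Proof.
elim: k GG => [|k IH] GG uG [dG dG']; first exact: Ck_family_series0.
have [c b _] : Ck_family 0 [set fseries g | g in GG].
  by apply: Ck_family_series0 => // n; case: (uG n) => ? ? _; split.
have dser v g z : GG g -> rd v (fseries g) z (fseries (fun n => rderive v (g n)) z).
  move=> Gg; pose V := complex.Re `|v|.
  have dV : decays (derived_seq V GG) by move: (dG' V); case: (k) => [|?] [].
  apply: (@rd_fseries GG (derived_seq V GG) v g z dG Gg dV) => [|n y]; first by exists v, g; split=> //; rewrite /V -norm_realE.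
  by apply: Ck_family_rderivable (uG n) _; exists g.
split=> //; split=> [_ v z [g Gg <-]|V]; first exact: rd_derivable (dser v g z Gg).
apply: Ck_family_sub (IH _ _ (dG' V)) => [_ [v [_ [vV [g Gg <-] ->]]]|n].
  exists (fun n => rderive v (g n)); first by exists v, g.
  by apply/funext => z; apply/esym/rdE/dser.
apply: Ck_family_sub (Ck_family_derived V (uG n)) => _ [_ [v [g [vV Gg ->]]] <-].
by exists v, (g n); split=> //; exists g.
Qed.

End UniformSeries.

(** * Flat functions *)

Section FlatFunctions.
Context {R : realType}.
Implicit Types (p : {poly R}) (x y : R).

Lemma is_derive_local (f g : R -> R) x l d : 0 < d ->
  (forall h, `|h| < d -> f (x + h) = g (x + h)) ->
  is_derive x 1 g l -> is_derive x 1 f l.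
Proof.
move=> d0 fg /is_derive1P dg; apply/is_derive1P => e /dg[d' d'0 H].
exists (Num.min d d'); first by rewrite lt_min d0.
move=> h; rewrite lt_min => /andP[hd hd'].
by rewrite fg// -[x in f x]addr0 fg ?normr0// addr0; exact: H.
Qed.

Lemma is_derive1_continuous (f df : R -> R) :
  (forall x, is_derive x 1 f (df x)) -> continuous f.
Proof.
by move=> dff x; apply/differentiable_continuous/derivable1_diffP; case: (dff x).
Qed.

Lemma expr_le_expR n x : 0 <= x -> x ^+ n <= n`!%:R * expR x.
Proof.
elim: n x => [|n IH] x x0.
  by rewrite expr0 fact0 mul1r; have := expR_ge1Dx x; lra.
have [->|xn0] := eqVneq x 0; first by rewrite exprS mul0r mulr_ge0// expR_ge0.
pose F y := n.+1`!%:R * expR y - y ^+ n.+1.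
have dF y : is_derive y 1 F (n.+1`!%:R * expR y - n.+1%:R * y ^+ n).
  have dE := @is_deriveZ _ _ _ expR n.+1`!%:R y 1 _ (is_derive_expR y).
  have := is_deriveB dE (is_deriveX n.+1 (is_derive_id y 1)).
  by rewrite exprfctE [_ *: 1]mulr1.
have [y] := MVT_segment x0 (fun y _ => dF y)
  (continuous_subspaceT (is_derive1_continuous dF)).
rewrite in_itv/= => /andP[y0 yx]; rewrite /F expR0 expr0n/= subr0 mulr1 => E.
suff : 0 <= n.+1`!%:R * expR x - x ^+ n.+1 - n.+1`!%:R by have := ler0n R n.+1`!; lra.
rewrite E mulr_ge0// ?subr0// factS natrM -mulrA -mulrBr mulr_ge0//.
by rewrite subr_ge0 IH.
Qed.

(* [p(1/y) exp(-1/y)] for [y > 0], extended by [0]: the class of such functions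
   is closed under differentiation. *)
Definition flat p y : R := if 0 < y then p.[y^-1] * expR (- y^-1) else 0.

(** With [u = 1/y], the derivative of [p(u) exp(-u)] in [u] is [(p' - p)(u) exp(-u)], and the chain
    rule contributes [- u^2]. *)
Definition flat_deriv p : {poly R} := 'X^2 * (p - p^`()).

(** The exponential beats [u^(i+2)] for every monomial [u^i] of [p(u)]. The spare factor [y ^+ 2] is
    what makes the derivative at 0 vanish. *)
Lemma flat_small p : exists2 C, 0 <= C & forall y, 0 < y -> `|flat p y| <= C * y ^+ 2.
Proof.
pose C : R := \sum_(i < size p) `|p`_i| * (i + 2)`!%:R.
exists C; first by apply: sumr_ge0 => i _; rewrite mulr_ge0.
move=> y y0; rewrite /flat y0 normrM [`|expR _|]ger0_norm ?expR_ge0// expRN.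
rewrite ler_pdivrMr ?expR_gt0// horner_coef (le_trans (ler_norm_sum _ _ _))//.
rewrite mulrAC -ler_pdivrMr ?exprn_gt0// mulr_suml mulr_suml; apply: ler_sum => i _.
rewrite normrM -!mulrA ler_wpM2l// normrX ger0_norm; last by rewrite invr_ge0 ltW.
by rewrite -exprVn -exprD; apply: expr_le_expR; rewrite invr_ge0 ltW.
Qed.

Lemma is_derive_flat p y : is_derive y 1 (flat p) (flat (flat_deriv p) y).
Proof.
have [y0|y0|<-] := ltgtP 0 y.
- apply: (@is_derive_local _ (fun y => p.[y^-1] * expR (- y^-1)) _ _ y) => // [h hy|].
    by rewrite /flat ifT//; have := ler_norm (- h); rewrite normrN; lra.
  have dV : is_derive y 1 (fun y : R => y^-1) (- y ^- 2).
    apply: is_derive_eq; first exact: (is_deriveV (lt0r_neq0 y0) (is_derive_id _ _)).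
    exact: mulr1.
  have dp := @is_derive1_comp R (horner p) (fun y => y^-1) y _ _ (is_derive_poly p y^-1) dV.
  have dE := @is_derive1_comp R expR (fun y => - y^-1) y _ _ (is_derive_expR (- y^-1)) (is_deriveN dV).
  have := is_deriveM dp dE; rewrite /flat y0 => H.
  apply: (is_derive_eq H).
  rewrite /flat_deriv !hornerE /= /GRing.scale/=.
  by rewrite -exprVn; ring.
- apply: (@is_derive_local _ (fun=> 0) _ _ (- y)); first by rewrite oppr_gt0.
    by move=> h hy; rewrite /flat ifF//; apply/negbTE; rewrite -leNgt; have := ler_norm h; lra.
  by rewrite /flat ltNge (ltW y0)/=; exact: is_derive_cst.
- rewrite {2}/flat ltxx; apply/is_derive1P => e e0; have [C C0 HC] := flat_small p.
  exists (e / (C + 1)); first by rewrite divr_gt0//; lra.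
  move=> h hd; rewrite add0r [flat p 0]/flat ltxx mulr0 !subr0.
  have [h0|h0] := ltP 0 h; last by rewrite /flat ltNge h0/= normr0 mulr_ge0// ltW.
  apply: le_trans (HC h h0) _; rewrite [`|h|]ger0_norm ?(ltW h0)// expr2 mulrA.
  rewrite ler_pM2r//; move: hd; rewrite ger0_norm ?(ltW h0)// ltr_pdivlMr; last by lra.
  by move: h0 C0; nra.
Qed.

(** For [y > 0] this is [y exp(-1/(2y))]: convex, flat at 0, of slope at most 1 and asymptotic to
    the line [y - 1/2]. It serves both as the [chi] of the domain and to round the corner in [smax].
    The inner factor 2 sets the offset to 1/2; with [y exp(-1/y)] the same argument would only give
    [0 <= smax]. *)
Definition flat_ramp y : R := y * flat 1 (2 * y).
Definition flat_ramp' y : R := flat (1 + 'X) (2 * y).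
Definition flat_ramp'' y : R := 2 * flat 'X^3 (2 * y).

Lemma is_derive_flat2 p y :
  is_derive y 1 (fun y => flat p (2 * y)) (2 * flat (flat_deriv p) (2 * y)).
Proof.
rewrite mulrC; apply: is_derive1_comp; first exact: is_derive_flat.
by have := @is_deriveZ _ _ _ id 2 y 1 _ (is_derive_id y 1); rewrite [2 *: 1]mulr1.
Qed.

Lemma is_derive_flat_ramp y : is_derive y 1 flat_ramp (flat_ramp' y).
Proof.
apply: (is_derive_eq (is_deriveM (is_derive_id y 1) (is_derive_flat2 1 y))).
rewrite /flat_ramp' /flat_deriv /flat /GRing.scale/= derivC subr0 !hornerE/=.
by case: ifPn => [y0|_]; rewrite ?hornerE/=; [field; lra|].
Qed.

Lemma is_derive_flat_ramp' y : is_derive y 1 flat_ramp' (flat_ramp'' y).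
Proof.
apply: (is_derive_eq (is_derive_flat2 _ y)).
rewrite /flat_ramp'' /flat_deriv derivD derivC derivX add0r addrAC subrr add0r.
by rewrite -exprSr.
Qed.

Lemma flat_ramp_ge0 y : 0 <= flat_ramp y.
Proof.
rewrite /flat_ramp /flat; case: ifPn => [y0|_]; last by rewrite mulr0.
by rewrite -polyC1 hornerC mul1r mulr_ge0 ?expR_ge0//; lra.
Qed.

Lemma flat_ramp_eq0 y : y <= 0 -> flat_ramp y = 0.
Proof. by move=> y0; rewrite /flat_ramp /flat ifF ?mulr0//; apply/negbTE; rewrite -leNgt; lra. Qed.

Lemma flat_ramp_le y : 0 <= y -> flat_ramp y <= y.
Proof.
move=> y0; rewrite /flat_ramp /flat; case: ifPn => [y0'|_]; last by rewrite mulr0.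
rewrite -polyC1 hornerC mul1r ler_piMr// -[leRHS]expR0 ler_expR oppr_le0 invr_ge0; lra.
Qed.

Lemma flat_ramp_ge y : y - 2^-1 <= flat_ramp y.
Proof.
rewrite /flat_ramp /flat; case: ifPn => [y0|]; last by rewrite -leNgt mulr0; lra.
rewrite -polyC1 hornerC mul1r; have := expR_ge1Dx (- (2 * y)^-1).
have yE : y * (2 * y)^-1 = 2^-1 by field; lra.
have y0' : 0 < y by lra.
rewrite -(ler_pM2l y0') mulrDr mulr1 mulrN yE; lra.
Qed.

Lemma flat_ramp'_ge0 y : 0 <= flat_ramp' y.
Proof.
rewrite /flat_ramp' /flat; case: ifPn => [y0|//].
by rewrite hornerD hornerX -polyC1 hornerC mulr_ge0 ?expR_ge0// addr_ge0// invr_ge0 ltW.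
Qed.

Lemma flat_ramp'_gt0 y : 0 < y -> 0 < flat_ramp' y.
Proof.
move=> y0; rewrite /flat_ramp' /flat ifT; last by rewrite mulr_gt0.
by rewrite hornerD hornerX -polyC1 hornerC mulr_gt0 ?expR_gt0// addr_gt0// invr_gt0 mulr_gt0.
Qed.

Lemma flat_ramp'_le1 y : flat_ramp' y <= 1.
Proof.
rewrite /flat_ramp' /flat; case: ifPn => [y0|//].
by rewrite hornerD hornerX -polyC1 hornerC expRN ler_pdivrMr ?expR_gt0// mul1r expR_ge1Dx.
Qed.

Lemma flat_ramp''_ge0 y : 0 <= flat_ramp'' y.
Proof.
rewrite /flat_ramp'' /flat; case: ifPn => [y0|_]; last by rewrite mulr0.
rewrite hornerXn mulr_ge0 => //; apply: mulr_ge0; last exact: expR_ge0.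
by rewrite exprn_ge0// invr_ge0 ltW.
Qed.

(* [x + flat_ramp (1 - x)] agrees with [x] for [x >= 1] and stays above [1/2], so
   [lnq] is a smooth function on the line which is [ln] beyond [1]. *)
Definition smax x : R := x + flat_ramp (1 - x).
Definition smax' x : R := 1 - flat_ramp' (1 - x).
Definition lnq x : R := ln (smax x).
Definition lnq' x : R := smax' x / smax x.
Definition lnq'' x : R := (flat_ramp'' (1 - x) * smax x - smax' x ^+ 2) / smax x ^+ 2.

Lemma is_derive_rev (f df : R -> R) x : (forall x, is_derive x 1 f (df x)) ->
  is_derive x 1 (fun x => f (1 - x)) (- df (1 - x)).
Proof.
move=> dff; rewrite -[- df _]mulrN1; apply: (@is_derive1_comp R f (fun x => 1 - x)).
by have := is_deriveB (is_derive_cst (1 : R) x (1 : R)) (is_derive_id x 1); rewrite sub0r.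
Qed.

Lemma is_derive_smax x : is_derive x 1 smax (smax' x).
Proof.
have := is_deriveD (is_derive_id x 1) (is_derive_rev x is_derive_flat_ramp).
by move=> H; apply: (is_derive_eq H).
Qed.

Lemma is_derive_smax' x : is_derive x 1 smax' (flat_ramp'' (1 - x)).
Proof.
have := is_deriveB (is_derive_cst (1 : R) x (1 : R)) (is_derive_rev x is_derive_flat_ramp').
by rewrite sub0r opprK.
Qed.

Lemma smax_ge x : 2^-1 <= smax x.
Proof. by rewrite /smax; have := flat_ramp_ge (1 - x); lra. Qed.

Lemma smax_gt0 x : 0 < smax x.
Proof. by have := smax_ge x; lra. Qed.

Lemma smaxE x : 1 <= x -> smax x = x.
Proof. by move=> x1; rewrite /smax flat_ramp_eq0 ?addr0//; lra. Qed.

Lemma smax_le x : smax x <= Num.max x 1.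
Proof.
have [x1|x1] := leP 1 x; first by rewrite smaxE.
by rewrite /smax; have := @flat_ramp_le (1 - x); lra.
Qed.

Lemma is_derive_lnq x : is_derive x 1 lnq (lnq' x).
Proof.
have := @is_derive1_comp R (@ln R) smax x _ _ (is_derive1_ln (smax_gt0 x)) (is_derive_smax x).
by move=> H; apply: (is_derive_eq H); rewrite mulrC.
Qed.

Lemma is_derive_lnq' x : is_derive x 1 lnq' (lnq'' x).
Proof.
have q0 := lt0r_neq0 (smax_gt0 x).
apply: (is_derive_eq (is_deriveM (is_derive_smax' x) (is_deriveV q0 (is_derive_smax x)))).
by rewrite /lnq'' /GRing.scale/=; field.
Qed.

(* With [g = |l|^2] for a complex affine [l], this is the sign condition making
   [lnq g] subharmonic. *)
Lemma lnq_subharmonic x : 0 <= x -> 0 <= lnq' x + x * lnq'' x.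
Proof.
move=> x0; have q0 := lt0r_neq0 (smax_gt0 x).
have -> : lnq' x + x * lnq'' x =
    (smax' x * (smax x - x * smax' x) + x * (flat_ramp'' (1 - x) * smax x)) / smax x ^+ 2.
  by rewrite /lnq' /lnq''; field.
apply: divr_ge0; last exact: sqr_ge0.
have := flat_ramp'_ge0 (1 - x); have := flat_ramp'_le1 (1 - x); have := flat_ramp_ge0 (1 - x).
have := flat_ramp''_ge0 (1 - x) => A B C D.
apply: addr_ge0; last by apply: mulr_ge0 => //; apply: mulr_ge0 => //; exact: ltW (smax_gt0 x).
rewrite mulr_ge0// /smax'; first by lra.
(* [smax x - x * smax' x] equals [flat_ramp (1 - x) + x * flat_ramp' (1 - x)], a sum of nonnegative
   terms. *)
by rewrite /smax mulrBr mulr1 opprB addrA; nra.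
Qed.

Lemma lnqE x : 1 <= x -> lnq x = ln x.
Proof. by move=> x1; rewrite /lnq smaxE. Qed.

End FlatFunctions.

(** * Smooth functions built from the coordinates *)

Section Coordinates.
Context {R : realType} {n : nat}.
Local Notation Cn := 'rV[R[i]]_n.
Implicit Types (z w : Cn) (j : 'I_n).

Lemma norm_coord_le z j : `|z 0 j| <= `|z|.
Proof.
rewrite -[`|z|]/(mx_norm z) mx_normE -[leLHS]nngE num_le.
by have := le_bigmax 0%:nng (fun i : 'I_1 * 'I_n => `|z i.1 i.2|%:nng) (0, j).
Qed.

Lemma norm_ge_Re (c : R[i]) (M : R) : `|c| <= M%:C -> `|complex.Re c| <= M.
Proof. by move=> cM; rewrite -lecR (le_trans (normc_ge_Re c)). Qed.

Lemma norm_ge_Im (c : R[i]) (M : R) : `|c| <= M%:C -> `|complex.Im c| <= M.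
Proof.
move=> cM; have := @norm_ge_Re ('i * c) M.
rewrite normrM (_ : `|'i| = 1) ?mul1r; last first.
  by rewrite normc_def/= expr0n/= add0r expr1n sqrtr1.
by case: c cM => a b cM /(_ cM)/=; rewrite mul0r mul1r sub0r normrN.
Qed.

Lemma lipschitz_continuous (V : normedModType R[i]) (f : V -> R) :
  (forall u v (M : R), `|u - v| <= M%:C -> `|f u - f v| <= M) -> continuous f.
Proof.
move=> fL u; apply/cvgrPdist_le => e e0; apply/nbhs_ballP; exists e%:C; first by rewrite /= ltcR.
by move=> v uv; apply: fL; move: uv; rewrite -ball_normE => /ltW.
Qed.

Lemma continuous_Re : continuous (fun c : R[i] => complex.Re c).
Proof.
by apply: (@lipschitz_continuous R[i]) => u v M uv; rewrite -raddfB; exact: norm_ge_Re.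
Qed.

Lemma continuous_Im : continuous (fun c : R[i] => complex.Im c).
Proof.
by apply: (@lipschitz_continuous R[i]) => u v M uv; rewrite -raddfB; exact: norm_ge_Im.
Qed.

(** Stronger than [smooth]: the singleton family also carries bounds for iterated derivatives on
    bounded sets, uniform over bounded directions. *)
Definition Coo (f : Cn -> R) := forall k, Ck_family k [set f].

Lemma Coo_smooth f : Coo f -> smooth f.
Proof. by move=> uf; exact: (Ck_family_smooth uf). Qed.

Lemma Coo_add f g : Coo f -> Coo g -> Coo (fun z => f z + g z).
Proof.
by move=> uf ug k; apply: Ck_family_sub (Ck_family_add (uf k) (ug k)) => _ ->; exists f, g.
Qed.

Lemma Coo_mul f g : Coo f -> Coo g -> Coo (fun z => f z * g z).
Proof.
by move=> uf ug k; apply: Ck_family_sub (Ck_family_mul (uf k) (ug k)) => _ ->; exists f, g.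
Qed.

Lemma Coo_cst c : Coo (fun=> c).
Proof. by move=> k; apply: Ck_family_sub (Ck_family_cst k `|c|) => _ ->; exists c. Qed.

Lemma Coo_Re j : Coo (fun z => complex.Re (z 0 j)).
Proof.
move=> k; apply: (@Ck_family_linear _ _ _ _ 1) => [z|u v|c v|M z zM].
- by apply: continuous_comp; [exact: coord_continuous|exact: continuous_Re].
- by rewrite mxE raddfD.
- by rewrite mxE; case: (v 0 j) => a b /=; rewrite mul0r subr0.
- by rewrite mul1r; apply: norm_ge_Re; exact: le_trans (norm_coord_le z j) zM.
Qed.

Lemma Coo_Im j : Coo (fun z => complex.Im (z 0 j)).
Proof.
move=> k; apply: (@Ck_family_linear _ _ _ _ 1) => [z|u v|c v|M z zM].
- by apply: continuous_comp; [exact: coord_continuous|exact: continuous_Im].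
- by rewrite mxE raddfD.
- by rewrite mxE; case: (v 0 j) => a b /=; rewrite mul0r addr0.
- by rewrite mul1r; apply: norm_ge_Im; exact: le_trans (norm_coord_le z j) zM.
Qed.

Lemma Coo_comp (phi : nat -> R -> R) f :
  (forall i (x : R), is_derive x (1 : R) (phi i) (phi i.+1 x)) -> Coo f -> Coo (phi 0 \o f).
Proof.
move=> dphi uf k; apply: Ck_family_sub (Ck_family_comp (D := setT) (phi := phi) _ _ _ (uf k) 0) => //.
- by move=> _ ->; exists f.
- move=> i B; have [B0|B0] := leP 0 B; last first.
    by exists 0 => x _ xB; have := normr_ge0 x; lra.
  have BB : - B <= B by lra.
  have c : continuous (fun x => `|phi i x|).
    move=> x; apply: continuous_comp; last exact: norm_continuous.
    exact: (is_derive1_continuous (dphi i)).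
  have [x _ H] := EVT_max BB (continuous_subspaceT c).
  by exists `|phi i x| => y _ yB; apply: H; rewrite in_itv/= -ler_norml.
Qed.

Lemma Coo_expR f : Coo f -> Coo (fun z => expR (f z)).
Proof. by move=> uf; apply: (@Coo_comp (fun=> expR)) => // _ x; exact: is_derive_expR. Qed.

Lemma Coo_flat p f : Coo f -> Coo (fun z => flat p (f z)).
Proof.
move=> uf; apply: (@Coo_comp (fun i => flat (iter i flat_deriv p))) => // i x.
exact: is_derive_flat.
Qed.

Lemma Coo_flat_ramp f : Coo f -> Coo (fun z => flat_ramp (f z)).
Proof.
move=> uf; apply: Coo_mul => //; apply: Coo_flat; apply: Coo_mul => //; exact: Coo_cst.
Qed.

Fixpoint ln_tower (i : nat) : R -> R :=
  if i is i'.+1 then fun x => (-1) ^+ i' * i'`!%:R * x ^- i'.+1 else @ln R.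

Lemma Coo_ln (c : R) f : 0 < c -> (forall z, c <= f z) -> Coo f -> Coo (fun z => ln (f z)).
Proof.
move=> c0 cf uf k.
apply: Ck_family_sub (Ck_family_comp (D := [set x | c <= x]) (phi := ln_tower) _ _ _ (uf k) 0) => //.
- by move=> _ ->; exists f.
- move=> [|i] x /= cx; have x0 : 0 < x by exact: lt_le_trans cx.
    by apply: (is_derive_eq (is_derive1_ln x0)); rewrite expr0 mul1r fact0 mul1r expr1.
  have xn0 : x ^+ i.+1 != 0 by rewrite expf_neq0// lt0r_neq0.
  have dX := is_deriveX i.+1 (is_derive_id x 1).
  rewrite exprfctE in dX.
  have H := @is_deriveZ _ _ _ _ ((-1) ^+ i * i`!%:R) _ _ _ (@is_deriveV R (fun y => y ^+ i.+1) x _ _ xn0 dX).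
  apply: (is_derive_eq H).
  rewrite /GRing.scale/= factS natrM exprS !exprS; field.
  by rewrite !expf_neq0// lt0r_neq0.
- move=> [|i] B.
    exists (`|ln c| + `|ln B|) => x /= cx xB.
    have x0 : 0 < x by exact: lt_le_trans cx.
    have xB' : x <= B by rewrite (le_trans _ xB)// ler_norm.
    have : ln c <= ln x by rewrite ler_ln// posrE.
    have : ln x <= ln B by rewrite ler_ln// posrE// (lt_le_trans x0).
    rewrite ler_norml; have := ler_norm (ln B); have := ler_norm (- ln c).
    by rewrite normrN; have := normr_ge0 (ln c); have := normr_ge0 (ln B); lra.
  exists (i`!%:R * c ^- i.+1) => x /= cx _; have x0 : 0 < x by exact: lt_le_trans cx.
  rewrite !normrM normrX normrN1 expr1n mul1r normfV normrX [`|x|]ger0_norm ?(ltW x0)//.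
  rewrite ger0_norm// ler_wpM2l// lef_pV2 ?posrE ?exprn_gt0//.
  by rewrite lerXn2r// nnegrE ltW.
- by move=> _ z ->; exact: cf.
Qed.

Lemma Coo_lnq f : Coo f -> Coo (fun z => lnq (f z)).
Proof.
move=> uf; apply: (@Coo_ln 2^-1) => [|z|]; [by []|exact: smax_ge|].
apply: Coo_add => //; apply: Coo_flat_ramp; apply: Coo_add; first exact: Coo_cst.
have -> : (fun z => - f z) = (fun z => (-1) * f z) by apply/funext => z; rewrite mulN1r.
by apply: Coo_mul => //; exact: Coo_cst.
Qed.

End Coordinates.

(** * Second-order calculus along a direction *)

Section Jets.
Context {R : realType} {E : normedModType R[i]}.
Implicit Types (f g : E -> R) (w z : E).

(** Explicit first and second derivatives, propagated through sums, products and compositions, give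
    the Hessian terms of [levi_formE] in closed form. *)
Definition jet w f (f1 f2 : E -> R) :=
  (forall z, rd w f z (f1 z)) /\ (forall z, rd w f1 z (f2 z)).

Lemma jet_rderives w f f1 f2 z : jet w f f1 f2 -> rderives [:: w; w] f z = f2 z.
Proof.
move=> [d1 d2]; rewrite /rderives/= (_ : rderive w f = f1); first exact: rdE.
by apply/funext => y; exact: rdE.
Qed.

Lemma jet_ext w f f1 f2 g1 g2 : jet w f f1 f2 -> f1 =1 g1 -> f2 =1 g2 -> jet w f g1 g2.
Proof. by move=> + /funext <- /funext <-. Qed.

Lemma rd_cst (c : R) w z : rd w (fun=> c) z 0.
Proof. exact: is_derive_cst. Qed.

Lemma rd_add2 w f g z a b : rd w f z a -> rd w g z b -> rd w (fun y => f y + g y) z (a + b).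
Proof. exact: is_deriveD. Qed.

Lemma rd_mul w f g z a b : rd w f z a -> rd w g z b ->
  rd w (fun y => f y * g y) z (f z * b + g z * a).
Proof. by move=> df dg; have := is_deriveM df dg; rewrite scale0r addr0. Qed.

Lemma rd_comp w (X : R -> R) f z a b : is_derive (f z) 1 X b -> rd w f z a ->
  rd w (fun y => X (f y)) z (b * a).
Proof.
move=> dX df; apply: (@is_derive1_comp R X (fun t : R => f (z + t%:C *: w))) df.
by rewrite scale0r addr0.
Qed.

Lemma jet_cst w (c : R) : jet w (fun=> c) (fun=> 0) (fun=> 0).
Proof. by split=> z; exact: rd_cst. Qed.

Lemma jet_add w f f1 f2 g g1 g2 : jet w f f1 f2 -> jet w g g1 g2 ->
  jet w (fun z => f z + g z) (fun z => f1 z + g1 z) (fun z => f2 z + g2 z).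
Proof. by move=> [df df1] [dg dg1]; split=> z; exact: rd_add2. Qed.

Lemma jet_mul w f f1 f2 g g1 g2 : jet w f f1 f2 -> jet w g g1 g2 ->
  jet w (fun z => f z * g z) (fun z => f z * g1 z + g z * f1 z)
    (fun z => f z * g2 z + 2 * (f1 z * g1 z) + g z * f2 z).
Proof.
move=> [df df1] [dg dg1]; split=> z; first exact: rd_mul.
apply: (is_derive_eq (rd_add2 (rd_mul (df z) (dg1 z)) (rd_mul (dg z) (df1 z)))).
by ring.
Qed.

Lemma jet_comp w (X X1 X2 : R -> R) f f1 f2 :
  (forall x : R, is_derive x (1 : R) X (X1 x)) -> (forall x : R, is_derive x (1 : R) X1 (X2 x)) ->
  jet w f f1 f2 ->
  jet w (fun z => X (f z)) (fun z => X1 (f z) * f1 z)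
    (fun z => X2 (f z) * f1 z ^+ 2 + X1 (f z) * f2 z).
Proof.
move=> dX dX1 [df df1]; split=> z; first exact: rd_comp.
apply: (is_derive_eq (rd_mul (rd_comp (dX1 (f z)) (df z)) (df1 z))).
by ring.
Qed.

End Jets.

Section SquaredModulus.
Context {R : realType} {n : nat}.
Local Notation Cn := 'rV[R[i]]_n.
Implicit Types (c d : R) (z w : Cn) (j : 'I_n).

Local Notation re j z := (complex.Re (z 0 j)).
Local Notation im j z := (complex.Im (z 0 j)).

(* [|c + d z_j|^2] and its derivatives along [w]. *)
Definition sqm c d j z : R := (c + d * re j z) ^+ 2 + (d * im j z) ^+ 2.
Definition sqm1 c d j w z : R :=
  2 * d * ((c + d * re j z) * re j w + d * im j z * im j w).
Definition sqm2 d j w : R := 2 * d ^+ 2 * (re j w ^+ 2 + im j w ^+ 2).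

Lemma sqm_ge0 c d j z : 0 <= sqm c d j z.
Proof. by rewrite addr_ge0 ?sqr_ge0. Qed.

Lemma sqm2_ge0 d j w : 0 <= sqm2 d j w.
Proof.
apply: mulr_ge0; last exact: addr_ge0 (sqr_ge0 _) (sqr_ge0 _).
by apply: mulr_ge0 => //; exact: sqr_ge0.
Qed.

Lemma rd_re j w z : rd w (fun z => re j z) z (re j w).
Proof.
apply/is_derive1P => e e0; exists 1 => // h _.
rewrite add0r scale0r addr0 !mxE (_ : _ - _ - _ = 0); last first.
  by case: (z 0 j) => a b; case: (w 0 j) => a' b' /=; ring.
by rewrite normr0 mulr_ge0// ltW.
Qed.

Lemma rd_im j w z : rd w (fun z => im j z) z (im j w).
Proof.
apply/is_derive1P => e e0; exists 1 => // h _.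
rewrite add0r scale0r addr0 !mxE (_ : _ - _ - _ = 0); last first.
  by case: (z 0 j) => a b; case: (w 0 j) => a' b' /=; ring.
by rewrite normr0 mulr_ge0// ltW.
Qed.

Lemma re_i j w : re j ('i *: w) = - im j w.
Proof. by rewrite mxE; case: (w 0 j) => a b /=; ring. Qed.

Lemma im_i j w : im j ('i *: w) = re j w.
Proof. by rewrite mxE; case: (w 0 j) => a b /=; ring. Qed.

Lemma jet_sqm c d j w : jet w (sqm c d j) (sqm1 c d j w) (fun=> sqm2 d j w).
Proof.
have jre : jet w (fun z => re j z) (fun=> re j w) (fun=> 0).
  by split=> z; [exact: rd_re|exact: rd_cst].
have jim : jet w (fun z => im j z) (fun=> im j w) (fun=> 0).
  by split=> z; [exact: rd_im|exact: rd_cst].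
have jr := jet_add (jet_cst w c) (jet_mul (jet_cst w d) jre).
have ji := jet_mul (jet_cst w d) jim.
have := jet_add (jet_mul jr jr) (jet_mul ji ji).
rewrite /sqm; under [X in jet _ X]eq_fun do rewrite -!expr2.
move=> /jet_ext; apply => z; rewrite /sqm1 /sqm2; ring.
Qed.

Lemma Coo_sqm c d j : Coo (sqm c d j).
Proof.
by apply: Coo_add; apply: Coo_mul; do ?apply: Coo_add; do ?apply: Coo_mul;
  do ?[exact: Coo_cst|exact: Coo_Re|exact: Coo_Im].
Qed.

(** With [l = c + d z_j], the derivatives of [|l|^2] along [w] and ['i *: w] are, up to sign, twice
    the real and imaginary parts of [conj(l) d w_j]; their squares add up to [4 |l|^2 |d w_j|^2]. *)
Lemma sqm_i c d j w z :
  sqm1 c d j w z ^+ 2 + sqm1 c d j ('i *: w) z ^+ 2 = 2 * sqm2 d j w * sqm c d j z.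
Proof. by rewrite /sqm1 /sqm2 /sqm re_i im_i; ring. Qed.

Lemma sqm2_i d j w : sqm2 d j ('i *: w) = sqm2 d j w.
Proof. by rewrite /sqm2 re_i im_i; ring. Qed.

Lemma norm_coordE z j : `|z 0 j| = (Num.sqrt (sqm 0 1 j z))%:C.
Proof. by rewrite normc_def /sqm add0r !mul1r. Qed.

(* A radial function [X (k |l|^2)] of an affine [l] is subharmonic as soon as
   [X' + t X'' >= 0]. *)
Lemma radial_psh c d j w z (k A B : R) : 0 <= k ->
  0 <= A + k * sqm c d j z * B ->
  0 <= (B * (k * sqm1 c d j w z) ^+ 2 + A * (k * sqm2 d j w)) +
       (B * (k * sqm1 c d j ('i *: w) z) ^+ 2 + A * (k * sqm2 d j ('i *: w))).
Proof.
move=> k0 AB.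
have -> : (B * (k * sqm1 c d j w z) ^+ 2 + A * (k * sqm2 d j w)) +
  (B * (k * sqm1 c d j ('i *: w) z) ^+ 2 + A * (k * sqm2 d j ('i *: w))) =
  B * k ^+ 2 * (sqm1 c d j w z ^+ 2 + sqm1 c d j ('i *: w) z ^+ 2) +
  2 * A * k * sqm2 d j w by rewrite sqm2_i; ring.
rewrite sqm_i.
have -> : B * k ^+ 2 * (2 * sqm2 d j w * sqm c d j z) + 2 * A * k * sqm2 d j w =
  2 * k * sqm2 d j w * (A + k * sqm c d j z * B) by ring.
by apply: mulr_ge0 => //; apply: mulr_ge0; [exact: mulr_ge0|exact: sqm2_ge0].
Qed.

End SquaredModulus.

(** * Vectors and polynomial curves in three complex dimensions *)

Section Rows.
Context {R : realType}.
Local Notation C3 := 'rV[R[i]]_3.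

Definition row3 (a b c : R[i]) : C3 := \row_(j < 3) [:: a; b; c]`_j.

Lemma row3E a b c : (row3 a b c 0 0 = a) * (row3 a b c 0 1 = b) * (row3 a b c 0 2 = c).
Proof. by rewrite !mxE. Qed.

Lemma row3P (u v : C3) : u 0 0 = v 0 0 -> u 0 1 = v 0 1 -> u 0 2 = v 0 2 -> u = v.
Proof.
move=> h0 h1 h2; apply/rowP => -[[|[|[|//]]] lt_j].
- by have -> : Ordinal lt_j = 0 by exact: val_inj.
- by have -> : Ordinal lt_j = 1 by exact: val_inj.
- by have -> : Ordinal lt_j = 2 by exact: val_inj.
Qed.

Lemma row3_ind (Q : 'I_3 -> Prop) : Q 0 -> Q 1 -> Q 2 -> forall j, Q j.
Proof.
move=> h0 h1 h2 -[[|[|[|//]]] lt_j].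
- by have -> : Ordinal lt_j = 0 by exact: val_inj.
- by have -> : Ordinal lt_j = 1 by exact: val_inj.
- by have -> : Ordinal lt_j = 2 by exact: val_inj.
Qed.

Lemma norm_row_le n (z : 'rV[R[i]]_n) (M : R[i]) : 0 <= M -> (forall j, `|z 0 j| <= M) -> `|z| <= M.
Proof.
move=> M0 zM; have [->|z0] := eqVneq `|z| 0; first by [].
have [[i j]] := mx_norm_neq0 z0.
by rewrite -[`|z|]/(mx_norm z) => -> /=; rewrite (ord1 i).
Qed.

Lemma closure_line (E : normedModType R[i]) (A : set E) (P v : E) :
  (forall t : R, 0 < t -> t < 1 -> A (P + t%:C *: v)) -> closure A P.
Proof.
move=> H B nB.
have : \forall t \near (0 : R), B (P + t%:C *: v).
  have := @cvg_line R E P v 0; rewrite scale0r addr0; exact.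
move=> /nbhs_ballP[d d0 dB].
pose t := Num.min d 1 / 2.
have m0 : 0 < Num.min d 1 by rewrite lt_min d0/=.
have tm : t < Num.min d 1 by rewrite /t; lra.
have t0 : 0 < t by rewrite divr_gt0.
move: tm; rewrite lt_min => /andP[td t1].
exists (P + t%:C *: v); split; first exact: H.
by apply: dB; rewrite /ball/= sub0r normrN gtr0_norm.
Qed.

End Rows.

Section Curves.
Context {R : realType}.
Local Notation C := R[i].
Local Notation C3 := 'rV[C]_3.

Lemma is_derive_horner (K : numFieldType) (p : {poly K}) (x : K) :
  is_derive x (1 : K) (horner p) p^`().[x].
Proof.
elim/poly_ind: p => [|p c IH].
  rewrite deriv0 horner0 (_ : horner 0 = cst 0); first exact: is_derive_cst.
  by apply/funext => y; rewrite horner0.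
rewrite (_ : horner _ = (horner p * id) + cst c); last first.
  by apply/funext => y; rewrite hornerMXaddC.
apply: (is_derive_eq (is_deriveD (is_deriveM IH (is_derive_id x 1)) (is_derive_cst c x 1))).
by rewrite derivMXaddC hornerD hornerMX /GRing.scale/=; ring.
Qed.

(** Both the curve germ in the boundary and the discs for the metric have polynomial components, so
    this supplies their holomorphy and their derivatives at the centre. *)
Lemma is_derive_curve (p0 p1 p2 : {poly C}) (x : C) :
  is_derive x (1 : C) (fun y => row3 p0.[y] p1.[y] p2.[y])
    (row3 p0^`().[x] p1^`().[x] p2^`().[x]).
Proof.
have scale (p : {poly C}) (v : C3) : is_derive x (1 : C) (fun y => p.[y] *: v) (p^`().[x] *: v).
  have dp := is_derive_horner p x.
  have cv : h^-1 *: (((fun y => p.[y] *: v) \o shift x) (h *: (1 : C)) - p.[x] *: v) @[h --> 0^'] --> p^`().[x] *: v.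
    under eq_fun do rewrite /= -scalerBl scalerA.
    apply: cvgZr_tmp.
    move: (@derive_val _ _ _ _ _ _ _ dp) => <-; exact: (@ex_derive _ _ _ _ _ _ _ dp).
  by apply: DeriveDef; [apply/cvg_ex; eexists; exact: cv|exact/cvg_lim].
have row3D a b c : row3 a b c = a *: row3 1 0 0 + b *: row3 0 1 0 + c *: row3 0 0 1.
  by apply: row3P; rewrite !mxE /=; ring.
rewrite [X in is_derive _ _ _ X]row3D.
rewrite (_ : (fun y => _) = (fun y => p0.[y] *: row3 1 0 0) + (fun y => p1.[y] *: row3 0 1 0) +
  (fun y => p2.[y] *: row3 0 0 1)); last by apply/funext => y; exact: row3D.
exact: (is_deriveD (is_deriveD (scale p0 _) (scale p1 _)) (scale p2 _)).
Qed.

End Curves.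

(** * The domain *)

Section Domain.
Context {R : realType}.
Local Notation C3 := 'rV[R[i]]_3.
Implicit Types (z w P : C3).
Variables (psi : C3 -> R) (psi1 psi2 : C3 -> C3 -> R).
Hypothesis psiS : Coo psi.
Hypothesis psiJ : forall w, jet w psi (psi1 w) (psi2 w).
Hypothesis psi_sh : forall w z, 0 <= psi2 w z + psi2 ('i *: w) z.
Hypothesis psi_dep : forall z z', z 0 0 = z' 0 0 -> psi z = psi z'.
Hypothesis psi0 : forall z, z 0 0 = 0 -> psi z = 0.
Hypothesis psi10 : forall w z, z 0 0 = 0 -> psi1 w z = 0.

Definition rfun z : R :=
  sqm 0 1 2 z * expR (psi z) + sqm 0 1 1 z + flat_ramp (sqm 0 1 0 z - 1) - 1.

Definition rfun1 w z : R :=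
  (sqm1 0 1 2 w z + sqm 0 1 2 z * psi1 w z) * expR (psi z) + sqm1 0 1 1 w z +
  flat_ramp' (sqm 0 1 0 z - 1) * sqm1 0 1 0 w z.

Definition rfun2 w z : R :=
  (sqm2 1 2 w + 2 * sqm1 0 1 2 w z * psi1 w z + sqm 0 1 2 z * psi1 w z ^+ 2 +
   sqm 0 1 2 z * psi2 w z) * expR (psi z) + sqm2 1 1 w +
  (flat_ramp'' (sqm 0 1 0 z - 1) * (1 * sqm1 0 1 0 w z) ^+ 2 +
   flat_ramp' (sqm 0 1 0 z - 1) * (1 * sqm2 1 0 w)).

Lemma rfun_jet w : jet w rfun (rfun1 w) (rfun2 w).
Proof.
have jE := jet_comp (@is_derive_expR R) (@is_derive_expR R) (psiJ w).
have j0 := jet_comp (@is_derive_flat_ramp R) (@is_derive_flat_ramp' R)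
  (jet_add (jet_sqm 0 1 0 w) (jet_cst w (-1))).
have := jet_add (jet_add (jet_add (jet_mul (jet_sqm 0 1 2 w) jE) (jet_sqm 0 1 1 w)) j0) (jet_cst w (-1)).
by move=> /jet_ext; apply => z; rewrite /rfun1 /rfun2; ring.
Qed.

Lemma rfun_US : Coo rfun.
Proof.
apply: Coo_add; last exact: Coo_cst.
apply: Coo_add; last first.
  by apply: Coo_flat_ramp; apply: Coo_add; [exact: Coo_sqm|exact: Coo_cst].
apply: Coo_add; last exact: Coo_sqm.
by apply: Coo_mul; [exact: Coo_sqm|exact: Coo_expR].
Qed.

Lemma rfun_smooth : smooth rfun.
Proof. exact: Coo_smooth rfun_US. Qed.

Lemma rfun_continuous : continuous rfun.
Proof. by case: (rfun_smooth [::]). Qed.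

(** [|w|^2 exp psi] is the exponential of the plurisubharmonic [ln |w|^2 + psi], and [chi] is convex
    and nondecreasing, so the defining function is plurisubharmonic on the whole space. *)
Lemma rfun_psh w z : 0 <= rfun2 w z + rfun2 ('i *: w) z.
Proof.
have h0 := @radial_psh R 3 0 1 0 w z 1 (flat_ramp' (sqm 0 1 0 z - 1)) (flat_ramp'' (sqm 0 1 0 z - 1)) ler01.
have {h0}/h0 : 0 <= flat_ramp' (sqm 0 1 0 z - 1) + 1 * sqm 0 1 0 z * flat_ramp'' (sqm 0 1 0 z - 1).
  by rewrite addr_ge0 ?flat_ramp'_ge0// mul1r mulr_ge0 ?flat_ramp''_ge0 ?sqm_ge0.
rewrite /rfun2; set A := (X in 0 <= X + _); set B := (X in 0 <= _ + X) => AB.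
have h1 := sqm2_ge0 1 1 w; have h2 := sqm2_ge0 1 1 ('i *: w).
have E0 := expR_ge0 (psi z); have sh := psi_sh w z.
rewrite [X in 0 <= X](_ : _ = ((sqm2 1 2 w + 2 * sqm1 0 1 2 w z * psi1 w z +
   sqm 0 1 2 z * psi1 w z ^+ 2 + sqm 0 1 2 z * psi2 w z) +
   (sqm2 1 2 ('i *: w) + 2 * sqm1 0 1 2 ('i *: w) z * psi1 ('i *: w) z +
   sqm 0 1 2 z * psi1 ('i *: w) z ^+ 2 + sqm 0 1 2 z * psi2 ('i *: w) z)) *
   expR (psi z) + (sqm2 1 1 w + sqm2 1 1 ('i *: w)) + (A + B)); last by rewrite /A /B; ring.
apply: addr_ge0 => //; apply: addr_ge0; last exact: addr_ge0.
apply: mulr_ge0 => //.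
have := mulr_ge0 (sqm_ge0 0 1 2 z) sh.
move: (psi1 w z) (psi1 ('i *: w) z) (psi2 w z) (psi2 ('i *: w) z) => p r p2 r2 H.
set a := complex.Re (z 0 2); set b := complex.Im (z 0 2).
set a' := complex.Re (w 0 2); set b' := complex.Im (w 0 2).
(* Completing the square: the two squares form [|2 w_2 + (p - i r) z_2|^2], where [p - i r] is twice
   the complex derivative of [psi] along [w]. Only the Laplacian of [psi] is left over. *)
rewrite [X in 0 <= X](_ : _ = (2 * a' + p * a + r * b) ^+ 2 + (2 * b' + p * b - r * a) ^+ 2 +
  sqm 0 1 2 z * (p2 + r2)).
  by apply: addr_ge0 => //; apply: addr_ge0; exact: sqr_ge0.
by rewrite /sqm1 /sqm2 /sqm re_i im_i -/a -/b -/a' -/b'; ring.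
Qed.

Lemma rfun_pseudoconvex Omega : pseudoconvex rfun Omega.
Proof.
move=> P _ w _; rewrite (levi_formE _ _ rfun_smooth) lecR mulr_ge0//.
by rewrite (jet_rderives P (rfun_jet w)) (jet_rderives P (rfun_jet ('i *: w))) rfun_psh.
Qed.

Definition Omega : set C3 := [set z | rfun z < 0].

Lemma open_Omega : open Omega.
Proof.
by apply: (@open_comp _ _ rfun [set x | x < 0]) => [z _|]; [exact: rfun_continuous|exact: open_lt].
Qed.

Lemma boundary_Omega P : boundary Omega P <-> closure Omega P /\ rfun P = 0.
Proof.
rewrite /boundary (proj1 (interior_id _) open_Omega); split=> [[cP nP]|[cP P0]].
  split=> //; apply/eqP; rewrite eq_le; apply/andP; split; last by rewrite leNgt; exact/negP.
  have cl : closed [set z | rfun z <= 0].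
    by apply: (@preimage_closed _ _ rfun [set x | x <= 0]) => [z _|]; [exact: rfun_continuous|exact: closed_le].
  by apply: cl; apply: closure_subset cP => z /ltW.
by split=> //; rewrite /Omega/= P0 ltxx.
Qed.

Lemma sqm1_self j w z : w 0 j = z 0 j -> sqm1 0 1 j w z = 2 * sqm 0 1 j z :> R.
Proof. by rewrite /sqm1 /sqm => ->; ring. Qed.

Lemma sqm1_0 j w z : w 0 j = 0 -> sqm1 0 1 j w z = 0 :> R.
Proof. by rewrite /sqm1 => ->; rewrite /=; ring. Qed.

Lemma sqm1_z0 j w z : z 0 j = 0 -> sqm1 0 1 j w z = 0 :> R.
Proof. by rewrite /sqm1 => ->; rewrite /=; ring. Qed.

Lemma psi1_fiber w z : w 0 0 = 0 -> psi1 w z = 0.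
Proof.
move=> w0; have [dpsi _] := psiJ w; rewrite -(rdE (dpsi z)); apply: rdE.
rewrite /rd (_ : (fun t : R => _) = fun=> psi z); first exact: is_derive_cst.
by apply/funext => t; apply: psi_dep; rewrite !mxE w0 mulr0 addr0.
Qed.

Lemma rfun_rderive w z : rderive w rfun z = rfun1 w z.
Proof. by case: (rfun_jet w) => d _; exact: rdE. Qed.

(** Differentiating along each coordinate part of [P] itself turns a vanishing gradient into
    vanishing moduli: the last two coordinates are 0. Then [rfun P = 0] says that [flat_ramp] equals
    1, which forces its argument to be positive, where its slope is positive; so the first
    coordinate is 0 as well, a contradiction. *)
Lemma rfun_defining : defining_function rfun Omega.
Proof.
split=> //; first exact: rfun_smooth.
move=> P /boundary_Omega[_ P0] G0.
have D0 w : rfun1 w P = 0.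
  rewrite -rfun_rderive; have := smooth_rderive_row [::] w P rfun_smooth.
  rewrite /rderives/= => ->; apply: big1 => j _.
  have /rowP/(_ j) := G0; rewrite !mxE => /eqP; rewrite eq_complex/= => /andP[/eqP -> /eqP ->].
  by rewrite !mulr0 addr0.
have m2 : sqm 0 1 2 P = 0.
  have := D0 (row3 0 0 (P 0 2)); rewrite /rfun1 psi1_fiber ?row3E// sqm1_self ?row3E//.
  rewrite !sqm1_0 ?row3E// !mulr0 !addr0 => /eqP.
  by rewrite !mulf_eq0 pnatr_eq0/= (gt_eqF (expR_gt0 _)) orbF => /eqP.
have m1 : sqm 0 1 1 P = 0.
  have := D0 (row3 0 (P 0 1) 0); rewrite /rfun1 psi1_fiber ?row3E//.
  rewrite (@sqm1_self 1) ?row3E// !sqm1_0 ?row3E// !mulr0 !addr0 mul0r add0r => /eqP.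
  by rewrite mulf_eq0 pnatr_eq0/= => /eqP.
have := D0 (row3 (P 0 0) 0 0); rewrite /rfun1 m2 mul0r (@sqm1_self 0) ?row3E//.
rewrite !sqm1_0 ?row3E// !addr0 mul0r add0r => /eqP.
move: P0; rewrite /rfun m2 m1 mul0r !add0r => P0.
have s0 : 0 < sqm 0 1 0 P - 1.
  by rewrite ltNge; apply/negP => /flat_ramp_eq0 h; move: P0; rewrite h; lra.
by rewrite !mulf_eq0 (gt_eqF (flat_ramp'_gt0 s0)) pnatr_eq0/= => /eqP; move: s0 => /[swap] ->; lra.
Qed.

Lemma bounded_Omega : bounded_set Omega.
Proof.
(* On the domain [flat_ramp_ge] gives [|z_0|^2 < 5/2], so a bound of [psi] on the ball of radius 2
   suffices; it yields [|z_2|^2 < exp B]. *)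
have [B HB] := Ck_family_bound 2 (psiS 0).
pose M := 3 + expR B.
exists M%:C; split; first by rewrite complex_real.
move=> K MK z /= Oz; apply: le_trans (ltW MK).
have := Oz; rewrite /Omega/= /rfun.
have E0 := expR_gt0 B.
have p2 : 0 <= sqm 0 1 2 z * expR (psi z) by rewrite mulr_ge0 ?sqm_ge0 ?expR_ge0.
have p1 := sqm_ge0 0 1 1 z; have p0 := flat_ramp_ge0 (sqm 0 1 0 z - 1).
have p0' := flat_ramp_ge (sqm 0 1 0 z - 1) => lt1.
have M1 : 1 <= M by rewrite /M; lra.
have sqrt_le (x y : R) : 0 <= y -> x <= y ^+ 2 -> Num.sqrt x <= y.
  move=> y0 xy; rewrite -(ger0_norm y0) -sqrtr_sqr; exact: ler_wsqrtr.
have z0 : Num.sqrt (sqm 0 1 0 z) <= 2 by apply: sqrt_le => //; lra.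
have B2 : sqm 0 1 2 z <= M ^+ 2.
  have psiB : - B <= psi z.
    rewrite (@psi_dep z (row3 (z 0 0) 0 0)) ?row3E//.
    have h : `|row3 (z 0 0) 0 0| <= (2 : R)%:C.
      apply: norm_row_le; first by rewrite lecR.
      apply: row3_ind; rewrite row3E; first by rewrite norm_coordE lecR.
        by rewrite normr0 lecR.
      by rewrite normr0 lecR.
    by have := HB psi _ erefl h; rewrite ler_norml => /andP[].
  have : sqm 0 1 2 z * expR (- B) < 1.
    apply: (@le_lt_trans _ _ (sqm 0 1 2 z * expR (psi z))); last by lra.
    by rewrite ler_wpM2l ?sqm_ge0// ler_expR.
  rewrite expRN ltr_pdivrMr// mul1r => lt2; apply: ltW; apply: lt_le_trans lt2 _.
  by rewrite expr2; apply: (@le_trans _ _ M); [rewrite /M; lra|rewrite ler_peMl//; lra].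
apply: norm_row_le => [|]; first by rewrite lecR; lra.
apply: row3_ind; rewrite norm_coordE lecR.
- by apply: le_trans z0 _; rewrite /M; lra.
- by apply: sqrt_le; [lra|nra].
- by apply: sqrt_le => //; lra.
Qed.

Lemma connected_line (E : normedModType R[i]) (p v : E) :
  connected [set p + t%:C *: v | t in `[0, 1]%classic : set R].
Proof.
apply: connected_continuous_connected; first exact: segment_connected.
by apply: continuous_subspaceT => t; exact: cvg_line.
Qed.

Lemma flat_ramp_mono (x y : R) : x <= y -> flat_ramp x <= flat_ramp y.
Proof.
move=> xy; have [c _] := MVT_segment xy (fun t _ => is_derive_flat_ramp t)
  (continuous_subspaceT (is_derive1_continuous (@is_derive_flat_ramp R))).
by rewrite -subr_ge0 => ->; rewrite mulr_ge0 ?flat_ramp'_ge0// subr_ge0.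
Qed.

(** Scaling all coordinates at once would move [psi] in an uncontrolled way. Instead the last
    coordinate is shrunk to 0 with [z_0] fixed, and then the base slides to the origin, where [psi]
    no longer enters. *)
Lemma connected_Omega : connected Omega.
Proof.
pose base z := row3 (z 0 0) (z 0 1) 0.
pose vert z := row3 0 0 (z 0 2).
pose A z := [set base z + t%:C *: vert z | t in `[0, 1]%classic : set R] `|`
            [set 0 + t%:C *: base z | t in `[0, 1]%classic : set R].
have -> : Omega = \bigcup_(z in Omega) A z.
  rewrite eqEsubset; split=> z.
    move=> Oz; exists z => //; left; exists 1; first by rewrite /= in_itv/= ler01 lexx.
    by rewrite scale1r; apply: row3P; rewrite !mxE /= ?addr0 ?add0r.
  have t2 (t s : R) : 0 <= t <= 1 -> 0 <= s -> t ^+ 2 * s <= s.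
    by move=> /andP[t0 t1] s0; rewrite ler_piMl// expr_le1.
  have sqm_scale (j : 'I_3) (y : C3) (t : R) : z 0 j = t%:C * y 0 j ->
      sqm 0 1 j z = t ^+ 2 * sqm 0 1 j y.
    by rewrite /sqm => ->; case: (y 0 j) => a b /=; ring.
  have sqm_eq (j : 'I_3) (y : C3) : z 0 j = y 0 j -> sqm 0 1 j z = sqm 0 1 j y.
    by rewrite /sqm => ->.
  case=> y Oy [] [t]; rewrite /= in_itv/= => t01 zE; apply: le_lt_trans Oy; rewrite /rfun.
  - have e0 : z 0 0 = y 0 0 by rewrite -zE !mxE /= mulr0 addr0.
    have e1 : z 0 1 = y 0 1 by rewrite -zE !mxE /= mulr0 addr0.
    have e2 : z 0 2 = t%:C * y 0 2 by rewrite -zE !mxE /= add0r.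
    rewrite (sqm_eq _ _ e0) (sqm_eq _ _ e1) (sqm_scale _ _ _ e2) (psi_dep e0) -mulrA.
    by rewrite !lerD2r t2// mulr_ge0 ?sqm_ge0 ?expR_ge0.
  - have e0 : z 0 0 = t%:C * y 0 0 by rewrite -zE !mxE /= add0r.
    have e1 : z 0 1 = t%:C * y 0 1 by rewrite -zE !mxE /= add0r.
    have e2 : z 0 2 = 0%:C * y 0 2 by rewrite -zE !mxE /= mul0r mulr0 add0r.
    rewrite (sqm_scale _ _ _ e0) (sqm_scale _ _ _ e1) (sqm_scale _ _ _ e2).
    rewrite lerD2r; apply: lerD; last by apply: flat_ramp_mono; rewrite lerD2r t2 ?sqm_ge0.
    by apply: lerD; rewrite ?t2 ?sqm_ge0// expr0n !mul0r mulr_ge0 ?sqm_ge0 ?expR_ge0.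
apply: bigcup_connected.
  exists 0 => z _; right; exists 0; first by rewrite /= in_itv/= ler01 lexx.
  by rewrite scale0r addr0.
move=> z _; apply: connectedU; [|exact: connected_line..].
exists (base z); split; [exists 0|exists 1]; rewrite /= ?in_itv/= ?lexx ?ler01//.
  by rewrite scale0r addr0.
by rewrite scale1r add0r.
Qed.

Lemma Omega0 : Omega 0.
Proof.
rewrite /Omega/= /rfun /sqm !mxE /= !(mulr0, add0r, addr0, expr0n)/= mul0r !add0r.
by rewrite flat_ramp_eq0 ?add0r//; lra.
Qed.

Lemma bounded_domain_Omega : bounded_domain Omega.
Proof.
split; first by exists 0; exact: Omega0.
- exact: open_Omega.
- exact: connected_Omega.
- exact: bounded_Omega.
Qed.

Lemma rfun_flat_vert z : z 0 2 = 0 -> complex.Re (z 0 0) ^+ 2 + complex.Im (z 0 0) ^+ 2 <= 1 ->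
  rfun z = sqm 0 1 1 z - 1.
Proof.
move=> z2 z01; rewrite /rfun flat_ramp_eq0; last by rewrite /sqm add0r !mul1r; lra.
by rewrite addr0 /sqm z2/= mulr0 addr0 expr0n/= addr0 mul0r add0r.
Qed.

Lemma boundary_disc : boundary Omega (row3 0 1 0).
Proof.
apply/boundary_Omega; split; last first.
  rewrite rfun_flat_vert ?row3E//; first by rewrite /sqm row3E /=; ring.
  by rewrite /= expr0n/= addr0.
apply: (@closure_line _ _ _ _ (row3 0 (-1) 0)) => t t0 t1.
have e0 : (row3 0 1 0 + t%:C *: row3 0 (-1) 0) 0 0 = 0 by rewrite !mxE/= mulr0 addr0.
have e1 : (row3 0 1 0 + t%:C *: row3 0 (-1) 0) 0 1 = (1 - t)%:C.
  by rewrite !mxE/= mulrN1 rmorphB.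
have e2 : (row3 0 1 0 + t%:C *: row3 0 (-1) 0) 0 2 = 0 by rewrite !mxE/= mulr0 addr0.
rewrite /Omega/= rfun_flat_vert ?e2// ?e0 ?/sqm ?e1/= ?expr0n/= ?addr0//.
by nra.
Qed.

Lemma rderives_near0 (E : normedModType R[i]) (f : E -> R) (U : set E) vs (z : E) :
  open U -> (forall y, U y -> f y = 0) -> U z -> rderives vs f z = 0.
Proof.
move=> oU f0; elim: vs z => [|v vs IH] z Uz; first exact: f0.
apply: rdE.
have : \forall t \near (0 : R), U (z + t%:C *: v).
  by apply: (@cvg_line _ _ z v 0); rewrite scale0r addr0; apply: open_nbhs_nbhs.
move=> /nbhs_ballP[d d0 dU].
apply: (@is_derive_local _ _ (fun=> 0) _ _ d) => // h hd.
by rewrite add0r; apply: IH; apply: dU; rewrite /ball/= sub0r normrN.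
Qed.

Lemma Omega_infinite_type : infinite_type rfun Omega.
Proof.
exists (row3 0 1 0); first exact: boundary_disc.
pose gam (y : R[i]) : C3 := row3 'X.[y] 1%:P.[y] 0%:P.[y].
have dgam (y : R[i]) : is_derive y (1 : R[i]) gam _ := is_derive_curve 'X 1%:P 0%:P y.
have type_ge (k : nat) : (k%:R%:E <= dAngelo_type rfun (row3 0 1 0)%R)%E.
  apply: ereal_sup_ubound; exists gam, 1%N, k; split; last by rewrite divr1.
    split=> //.
    - by exists setT; [exact: filterT|move=> y _; case: (dgam y)].
    - by rewrite /gam hornerX !hornerC.
    - by case.
    - rewrite derive1n1 derive1E (@derive_val _ _ _ _ _ _ _ (dgam 0%R)) derivX hornerE => /rowP/(_ 0).
      by rewrite !mxE/= => /eqP; rewrite oner_eq0.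
  move=> vs _; apply: (@rderives_near0 _ _ [set y : R[i] | complex.Re y ^+ 2 + complex.Im y ^+ 2 < 1]).
  - apply: (@open_comp _ _ (fun y : R[i] => complex.Re y ^+ 2 + complex.Im y ^+ 2) [set x | x < 1]).
      move=> y _; have cR := @continuous_Re R y; have cI := @continuous_Im R y.
      exact: (cvgD (cvgM cR cR) (cvgM cI cI)).
    exact: open_lt.
  - move=> y /= y1; rewrite rfun_flat_vert ?row3E ?hornerX ?hornerC//; last exact: ltW.
    by rewrite /sqm row3E hornerC/=; ring.
  - by rewrite /= expr0n/= addr0.
rewrite /finite_type_at; case: (dAngelo_type _ _) type_ge => [x| |] // type_ge _; last first.
  by have := type_ge 0%N.
have := type_ge (Num.truncn `|x|).+1; rewrite lee_fin => H.
have := truncnS_gt `|x|; have := ler_norm x; lra.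
Qed.

Lemma boundary_pole : boundary Omega (row3 0 0 1).
Proof.
apply/boundary_Omega; split; last first.
  by rewrite /rfun psi0 ?row3E// expR0 flat_ramp_eq0 /sqm ?row3E/= ?(mulr0, addr0, add0r, expr0n)/=; lra.
apply: (@closure_line _ _ _ _ (row3 0 0 (-1))) => t t0 t1.
rewrite /Omega/= /rfun psi0 ?mxE/= ?mulr0 ?addr0//.
rewrite expR0 flat_ramp_eq0 /sqm ?mxE/= ?mulr0 ?mul0r ?addr0 ?expr0n/= ?addr0; last by lra.
by nra.
Qed.

Lemma rfun1_pole w : rfun1 w (row3 0 0 1) = 2 * complex.Re (w 0 2).
Proof.
rewrite /rfun1 psi10 ?row3E// psi0 ?row3E// expR0 (@sqm1_z0 1 w) ?row3E// (@sqm1_z0 0 w) ?row3E// /sqm1 row3E/=.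
by ring.
Qed.

(** The first derivatives of [psi] vanish where [z_0 = 0], so the gradient has no component in the
    first coordinate. *)
Lemma normal_pole : unit_outward_normal rfun (row3 0 0 1) = row3 0 0 1.
Proof.
have G : gradient rfun (row3 0 0 1) = row3 0 0 (2 : R)%:C.
  by apply/rowP; apply: row3_ind; rewrite !mxE/= !rfun_rderive !rfun1_pole !mxE/=;
    apply/eqP; rewrite eq_complex/= ?(mulr0, mulr1, subr0, mul0r, addr0) !eqxx.
have N : euclidean_norm (row3 0 0 (2 : R)%:C) = 2 :> R.
  rewrite /euclidean_norm !big_ord_recr big_ord0/= !mxE/= !expr0n/= !addr0 add0r.
  by rewrite sqrtr_sqr ger0_norm.
rewrite /unit_outward_normal G N; apply: row3P; rewrite !mxE/= ?mulr0//.
by rewrite -rmorphM/= mulVf.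
Qed.

End Domain.

(** * Series with dominated derivatives *)

Section Series.
Context {R : realType} {n : nat}.
Local Notation Cn := 'rV[R[i]]_n.
Implicit Types (g : nat -> Cn -> R) (z w : Cn).

Lemma smoothly_decays_sub k (GG HH : set (nat -> Cn -> R)) :
  GG `<=` HH -> smoothly_decays k HH -> smoothly_decays k GG.
Proof.
elim: k GG HH => [|k IH] GG HH GH [dH dH']; split=> //.
1,2: by move=> M; have [N HN] := dH M; exists N => m g z Nm /GH; exact: HN.
move=> V; apply: IH (dH' V) => _ [v [g [vV Gg ->]]].
by exists v, g; split=> //; exact: GH.
Qed.

(** A diagonal condition: the [m]-th term is controlled up to order [m], for directions of length
    [m] and on the ball of radius [m]. Any fixed order, direction and ball are therefore covered
    from some index on. *)
Definition dominated g := forall m vs z, (size vs <= m)%N ->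
  (forall v, List.In v vs -> `|v| <= (m%:R : R)%:C) -> `|z| <= (m%:R : R)%:C ->
  `|rderives vs (g m) z| <= 2^-1 ^+ m.

Lemma dominated_decays g k : dominated g -> smoothly_decays k [set g].
Proof.
move=> gd.
(* The induction needs families stable under [derived_seq]: here one more derivative raises [j] by
   one and may enlarge [V]. *)
pose DS j (V : R) : set (nat -> Cn -> R) := [set h | exists vs, [/\ (size vs <= j)%N,
  forall v, List.In v vs -> `|v| <= V%:C & h = fun m => rderives vs (g m)]].
have nat_le (x : R) (m : nat) : ((Num.truncn `|x|).+1 <= m)%N -> x <= m%:R.
  move=> xm; apply: le_trans (ler_norm x) _; apply: le_trans (ltW (truncnS_gt _)) _.
  by rewrite ler_nat.
have dDS j V : decays (DS j V).
  move=> M; exists (maxn j (maxn (Num.truncn `|V|).+1 (Num.truncn `|M|).+1)) => m h z.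
  rewrite !geq_max => /and3P[jm Vm Mm] [vs [sj vsV ->]] zM; apply: gd.
  - exact: leq_trans jm.
  - by move=> v /vsV vV; apply: le_trans vV _; rewrite lecR nat_le.
  - by apply: le_trans zM _; rewrite lecR nat_le.
suff /(_ k 0%N 0) : forall k j V, smoothly_decays k (DS j V).
  by apply: smoothly_decays_sub => _ ->; exists [::].
elim=> [|k' IH] j V; split=> // V'.
apply: smoothly_decays_sub (IH j.+1 (Num.max V V')) => _ [v [_ [vV' [vs [sj vsV ->]] ->]]].
exists (v :: vs); split=> // u /= [<-|/vsV uV].
- by apply: le_trans vV' _; rewrite lecR le_max lexx orbT.
- by apply: le_trans uV _; rewrite lecR le_max lexx.
Qed.

Lemma Coo_series g : (forall m, Coo (g m)) -> dominated g -> Coo (fseries g).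
Proof.
move=> gS gd k.
have : Ck_family k [set fseries h | h in [set g]].
  apply: Ck_family_series; last exact: dominated_decays.
  by move=> m; apply: Ck_family_sub (gS m k) => _ [_ -> <-].
by apply: Ck_family_sub => _ ->; exists g.
Qed.

Section JetSeries.
Variables (g : nat -> Cn -> R) (w : Cn) (g1 g2 : nat -> Cn -> R).
Hypothesis gd : dominated g.
Hypothesis gj : forall m, jet w (g m) (g1 m) (g2 m).

Let V := complex.Re `|w|.

Let g1E m : rderive w (g m) = g1 m.
Proof. by apply/funext => z; case: (gj m) => d _; exact: rdE. Qed.

Let g2E m : rderive w (g1 m) = g2 m.
Proof. by apply/funext => z; case: (gj m) => _ d; exact: rdE. Qed.

Let in1 : derived_seq V [set g] g1.
Proof.
exists w, g; split=> //; first by rewrite /V -norm_realE.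
by apply/funext => m; rewrite g1E.
Qed.

Let in2 : derived_seq V (derived_seq V [set g]) g2.
Proof.
exists w, g1; split=> //; first by rewrite /V -norm_realE.
by apply/funext => m; rewrite g2E.
Qed.

Lemma jet_series : jet w (fseries g) (fseries g1) (fseries g2).
Proof.
have [d0 d1] := dominated_decays 2 gd; have [d2 _] := d1 V.
have [d3 _] := (d1 V).2 V.
have E1 : (fun m => rderive w (g m)) = g1 by apply/funext => m; rewrite g1E.
have E2 : (fun m => rderive w (g1 m)) = g2 by apply/funext => m; rewrite g2E.
split=> z.
- rewrite -E1; apply: (@rd_fseries _ _ _ _ w g z d0 erefl d2) => [|m y]; first by rewrite E1.
  by case: (gj m) => d _; exact: rd_derivable (d y).
- rewrite -E2; apply: (@rd_fseries _ _ _ _ w g1 z d2 in1 d3) => [|m y]; first by rewrite E2.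
  by case: (gj m) => _ d; exact: rd_derivable (d y).
Qed.

Lemma jet_series_cvg z : cvgn (series (g2^~ z)).
Proof.
have [_ d1] := dominated_decays 2 gd; have [d3 _] := (d1 V).2 V.
exact: decays_cvg d3 in2.
Qed.

End JetSeries.

Lemma rderives_scale (c : R) (f : Cn -> R) vs z : smooth f ->
  rderives vs (fun z => c * f z) z = c * rderives vs f z.
Proof.
move=> sf; elim: vs z => [//|v vs IH] z.
suff : rd v (rderives vs (fun z => c * f z)) z (c * rderives (v :: vs) f z) by exact: rdE.
rewrite (_ : rderives vs _ = fun z => c * rderives vs f z); last exact/funext.
have := rd_mul (rd_cst c v z) (smooth_rd vs v z sf).
by rewrite mulr0 addr0.
Qed.

End Series.

(** * The potential *)

Section Potential.
Context {R : realType}.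
Local Notation C3 := 'rV[R[i]]_3.
Implicit Types (z w : C3).
Variables (s tau : nat -> R).
Hypothesis s_gt0 : forall m, 0 < s m.
Hypothesis tau_gt0 : forall m, 0 < tau m.
Hypothesis tau_le1 : forall m, tau m <= 1.

(* [ln |1 + z_0 / s|^2 - 2 Re (z_0 / s)], smoothed inside the disc
   [|1 + z_0 / s|^2 < tau]; it vanishes to first order at [z_0 = 0]. *)
Definition pot m z : R :=
  lnq ((tau m)^-1 * sqm 1 (s m)^-1 0 z) + ln (tau m) - 2 * (s m)^-1 * complex.Re (z 0 0).

Definition pot1 m w z : R :=
  lnq' ((tau m)^-1 * sqm 1 (s m)^-1 0 z) * ((tau m)^-1 * sqm1 1 (s m)^-1 0 w z) -
  2 * (s m)^-1 * complex.Re (w 0 0).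

Definition pot2 m w z : R :=
  lnq'' ((tau m)^-1 * sqm 1 (s m)^-1 0 z) * ((tau m)^-1 * sqm1 1 (s m)^-1 0 w z) ^+ 2 +
  lnq' ((tau m)^-1 * sqm 1 (s m)^-1 0 z) * ((tau m)^-1 * sqm2 (s m)^-1 0 w).

Lemma pot_jet m w : jet w (pot m) (pot1 m w) (pot2 m w).
Proof.
have jk := jet_mul (jet_cst w (tau m)^-1) (jet_sqm 1 (s m)^-1 0 w).
have jre : jet w (fun z => complex.Re (z 0 0)) (fun=> complex.Re (w 0 0)) (fun=> 0).
  by split=> z; [exact: rd_re|exact: rd_cst].
have jl := jet_add (jet_comp (@is_derive_lnq R) (@is_derive_lnq' R) jk) (jet_cst w (ln (tau m))).
have := jet_add jl (jet_mul (jet_cst w (- (2 * (s m)^-1))) jre).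
rewrite (_ : (fun z => _ + - (2 * (s m)^-1) * _) = pot m); last first.
  by apply/funext => z; rewrite mulNr.
move=> /jet_ext; apply => z; rewrite /pot1 /pot2; ring.
Qed.

Lemma pot_US m : Coo (pot m).
Proof.
rewrite /pot; apply: Coo_add; last first.
  rewrite (_ : (fun z => _) = fun z => - (2 * (s m)^-1) * complex.Re (z 0 0)).
    by apply: Coo_mul; [exact: Coo_cst|exact: Coo_Re].
  by apply/funext => z; rewrite mulNr.
apply: Coo_add; last exact: Coo_cst.
by apply: Coo_lnq; apply: Coo_mul; [exact: Coo_cst|exact: Coo_sqm].
Qed.

Lemma pot_sh m w z : 0 <= pot2 m w z + pot2 m ('i *: w) z.
Proof.
apply: radial_psh; first by rewrite invr_ge0 ltW.
apply: lnq_subharmonic; rewrite mulr_ge0 ?sqm_ge0// invr_ge0 ltW//.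
Qed.

Lemma sqm_at0 m z : z 0 0 = 0 -> sqm 1 (s m)^-1 0 z = 1.
Proof. by rewrite /sqm => ->; rewrite /=; ring. Qed.

Lemma tau_inv_ge1 m : 1 <= (tau m)^-1.
Proof. by rewrite invf_ge1. Qed.

Lemma pot_at0 m z : z 0 0 = 0 -> pot m z = 0.
Proof.
move=> z0; rewrite /pot sqm_at0// mulr1 lnqE ?tau_inv_ge1// lnV ?posrE// z0/=.
by ring.
Qed.

Lemma pot1_at0 m w z : z 0 0 = 0 -> pot1 m w z = 0.
Proof.
move=> z0; have t1 := tau_inv_ge1 m; rewrite /pot1 sqm_at0// mulr1 /lnq' smaxE// /smax'.
have -> : flat_ramp' (1 - (tau m)^-1) = 0 :> R.
  by rewrite /flat_ramp' /flat ifF//; apply/negbTE; rewrite -leNgt; lra.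
rewrite subr0 invrK mul1r mulrA mulfV ?lt0r_neq0// mul1r /sqm1 z0/=; ring.
Qed.

Lemma pot_dep m z z' : z 0 0 = z' 0 0 -> pot m z = pot m z'.
Proof. by rewrite /pot /sqm => ->. Qed.

Variable dlt : nat -> R.
Hypothesis dlt_ge0 : forall m, 0 <= dlt m.
Hypothesis dlt_dom : dominated (fun m z => dlt m * pot m z).

Definition psi := fseries (fun m z => dlt m * pot m z).
Definition psi1 w := fseries (fun m z => dlt m * pot1 m w z).
Definition psi2 w := fseries (fun m z => dlt m * pot2 m w z).

Lemma wpot_jet m w : jet w (fun z => dlt m * pot m z)
  (fun z => dlt m * pot1 m w z) (fun z => dlt m * pot2 m w z).
Proof.
have := jet_mul (jet_cst w (dlt m)) (pot_jet m w).
by move=> /jet_ext; apply => z; ring.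
Qed.

Lemma psi_US : Coo psi.
Proof.
apply: (@Coo_series _ _ (fun m z => dlt m * pot m z)) => [m|]; last exact: dlt_dom.
exact: (Coo_mul (Coo_cst (dlt m)) (pot_US m)).
Qed.

Lemma psi_jet w : jet w psi (psi1 w) (psi2 w).
Proof.
apply: (@jet_series _ _ _ w (fun m z => dlt m * pot1 m w z) (fun m z => dlt m * pot2 m w z) dlt_dom) => m.
exact: wpot_jet.
Qed.

Lemma psi_sh w z : 0 <= psi2 w z + psi2 ('i *: w) z.
Proof.
have c u : cvgn (series ((fun m z => dlt m * pot2 m u z)^~ z)).
  apply: (@jet_series_cvg _ _ _ u (fun m z => dlt m * pot1 m u z)
    (fun m z => dlt m * pot2 m u z) dlt_dom) => m.
  exact: wpot_jet.
rewrite -lim_seriesD//; apply: limr_ge; first exact: is_cvg_seriesD.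
near=> m; apply: sumr_ge0 => j _.
by rewrite -[_ j]/(_ + _) -mulrDr mulr_ge0 ?pot_sh.
Unshelve. all: by end_near. Qed.

Lemma psi_dep z z' : z 0 0 = z' 0 0 -> psi z = psi z'.
Proof.
move=> zz'; rewrite /psi /fseries; congr (limn (series _)).
by apply/funext => m; rewrite (pot_dep m zz').
Qed.

Lemma fseries0 (g : nat -> C3 -> R) z : (forall m, g m z = 0) -> fseries g z = 0.
Proof.
move=> g0; rewrite /fseries (_ : series _ = fun=> 0); first exact: lim_cst.
by apply/funext => m; rewrite /series/= big1.
Qed.

Lemma psi_at0 z : z 0 0 = 0 -> psi z = 0.
Proof. by move=> z0; apply: fseries0 => m; rewrite pot_at0// mulr0. Qed.

Lemma psi1_at0 w z : z 0 0 = 0 -> psi1 w z = 0.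
Proof. by move=> z0; apply: fseries0 => m; rewrite pot1_at0// mulr0. Qed.

End Potential.

(** * The discs *)

Section LogApproximation.
Context {R : realType}.
Local Notation C := R[i].
Implicit Types (x y u : C) (p : {poly C}).

(** A real-valued squared modulus, since [|x|] lives in [R[i]] and involves a square root. *)
Definition nsq x : R := complex.Re x ^+ 2 + complex.Im x ^+ 2.

Lemma nsq_ge0 x : 0 <= nsq x.
Proof. by rewrite addr_ge0 ?sqr_ge0. Qed.

Lemma nsqM x y : nsq (x * y) = nsq x * nsq y.
Proof. by case: x y => a b [c d]; rewrite /nsq/=; ring. Qed.

Lemma nsqX x k : nsq (x ^+ k) = nsq x ^+ k.
Proof.
elim: k => [|k IH]; first by rewrite !expr0 /nsq/= expr0n/= addr0 expr1n.
by rewrite !exprS nsqM IH.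
Qed.

Lemma nsqR (t : R) : nsq t%:C = t ^+ 2.
Proof. by rewrite /nsq/= expr0n/= addr0. Qed.

Lemma nsqN x : nsq (- x) = nsq x.
Proof. by case: x => a b; rewrite /nsq/=; ring. Qed.

Lemma nsqD_le x y : nsq (x + y) <= 2 * nsq x + 2 * nsq y.
Proof.
case: x y => a b [c d]; rewrite /nsq/=.
have := sqr_ge0 (a - c); have := sqr_ge0 (b - d); lra.
Qed.

Lemma norm_nsq x : `|x| = (Num.sqrt (nsq x))%:C.
Proof. by rewrite normc_def. Qed.

(** Applied to [x / k] and raised to the power [k], this bounds a polynomial by [exp(2 Re x)] up to
    a factor [exp(nsq x / k)]. Both the profile and the last component of the disc are estimated in
    this way. *)
Lemma nsq1D_le x : nsq (1 + x) <= expR (2 * complex.Re x + nsq x).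
Proof.
apply: le_trans (expR_ge1Dx _).
by case: x => a b; rewrite /nsq/= le_eqVlt; apply/orP; left; apply/eqP; ring.
Qed.

Lemma horner_bounded p : exists2 K : R, 0 <= K & forall x, nsq x <= 1 -> nsq p.[x] <= K.
Proof.
elim/poly_ind: p => [|p c [K K0 HK]].
  by exists 0 => // x _; rewrite horner0 /nsq/= expr0n/= addr0.
exists (2 * K + 2 * nsq c) => [|x x1]; first by have := nsq_ge0 c; lra.
rewrite hornerMXaddC; apply: le_trans (nsqD_le _ _) _.
rewrite nsqM lerD2r ler_pM2l//.
by apply: le_trans (HK x x1); rewrite ler_piMr ?nsq_ge0.
Qed.

Lemma is_derive_horner_ray p u (t : R) :
  is_derive t (1 : R) (fun t : R => complex.Re p.[t%:C * u]) (complex.Re (u * p^`().[t%:C * u])) /\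
  is_derive t (1 : R) (fun t : R => complex.Im p.[t%:C * u]) (complex.Im (u * p^`().[t%:C * u])).
Proof.
case: u => a b.
elim/poly_ind: p => [|p c [dRe dIm]].
  rewrite deriv0 horner0 mulr0; split.
    by under eq_fun do rewrite horner0; exact: is_derive_cst.
  by under eq_fun do rewrite horner0; exact: is_derive_cst.
have dt (k : R) : is_derive t 1 (fun t : R => t * k) k.
  have := is_deriveM (is_derive_id t 1) (is_derive_cst k t 1).
  by rewrite scaler0 add0r => /is_derive_eq; apply; exact: mulr1.
have E (s : R) : (p * 'X + c%:P).[s%:C * (a +i* b)] =
    p.[s%:C * (a +i* b)] * (s%:C * (a +i* b)) + c by rewrite hornerMXaddC.
have hR := is_deriveD (is_deriveB (is_deriveM dRe (dt a)) (is_deriveM dIm (dt b)))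
  (is_derive_cst (complex.Re c) t 1).
have hI := is_deriveD (is_deriveD (is_deriveM dRe (dt b)) (is_deriveM dIm (dt a)))
  (is_derive_cst (complex.Im c) t 1).
rewrite derivMXaddC hornerD hornerMX; split.
- rewrite (_ : (fun s : R => _) = (((fun t => complex.Re p.[t%:C * (a +i* b)]) * (fun t => t * a) -
    (fun t => complex.Im p.[t%:C * (a +i* b)]) * (fun t => t * b)) + cst (complex.Re c))); last first.
    apply/funext => s; rewrite E !fctE; case: (p.[_]) (c) => d e [c1 c2] /=; ring.
  apply: (is_derive_eq hR); rewrite /GRing.scale/=.
  by case: (p.[_]) (p^`().[_]) => d e [d' e'] /=; ring.
- rewrite (_ : (fun s : R => _) = (((fun t => complex.Re p.[t%:C * (a +i* b)]) * (fun t => t * b) +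
    (fun t => complex.Im p.[t%:C * (a +i* b)]) * (fun t => t * a)) + cst (complex.Im c))); last first.
    apply/funext => s; rewrite E !fctE; case: (p.[_]) (c) => d e [c1 c2] /=; ring.
  apply: (is_derive_eq hI); rewrite /GRing.scale/=.
  by case: (p.[_]) (p^`().[_]) => d e [d' e'] /=; ring.
Qed.

Fixpoint log_taylor k : {poly C} :=
  if k is k'.+1 then log_taylor k' + ((-1) ^+ k' / k'.+1%:R) *: 'X^(k'.+1) else 0.

Lemma log_taylor0 k : (log_taylor k).[0] = 0.
Proof. by elim: k => [|k IH] /=; rewrite ?horner0// hornerD IH hornerZ hornerXn expr0n/= mulr0 addr0. Qed.

Lemma deriv_log_taylor k x : (1 + x) * (log_taylor k)^`().[x] = 1 - (- x) ^+ k.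
Proof.
elim: k => [|k IH] /=; first by rewrite deriv0 horner0 mulr0 expr0 subrr.
rewrite derivD hornerD mulrDr IH derivZ derivXn hornerZ hornerMn hornerXn/=.
have k0 : k.+1%:R != 0 :> C by rewrite pnatr_eq0.
rewrite -(mulr_natr (x ^+ k)).
have -> : (-1) ^+ k / k.+1%:R * (x ^+ k * k.+1%:R) = (- x) ^+ k :> C.
  by rewrite [in RHS]exprNn; field.
by rewrite exprS; ring.
Qed.

(** By the finite geometric sum the difference is [2 Re (u (-v)^k / (1 + v))] with [v = t u], and
    here [|u|] and [|v|] are at most 1/2 while [|1 + v|] is at least 1/2. *)
Lemma nsq_deriv_bound (t : R) u k : 0 <= t <= 1 -> nsq u <= 4^-1 ->
  2 * complex.Re (u / (1 + t%:C * u)) - 2 * complex.Re (u * (log_taylor k)^`().[t%:C * u])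
  <= 2 * 2^-1 ^+ k.
Proof.
move=> /andP[t0 t1] u4; set v := t%:C * u.
have v4 : nsq v <= 4^-1.
  rewrite /v nsqM nsqR; apply: le_trans u4; rewrite ler_piMl ?nsq_ge0//.
  by rewrite expr_le1.
have w4 : 4^-1 <= nsq (1 + v).
  by move: v4; rewrite /nsq; case: v => c d /=; nra.
have w0 : 1 + v != 0.
  by apply/eqP => w0; move: w4; rewrite w0 /nsq/= expr0n/=; lra.
have -> : (log_taylor k)^`().[v] = (1 - (- v) ^+ k) / (1 + v).
  by rewrite -(deriv_log_taylor k v) mulrAC mulfV// mul1r.
set e := u * (- v) ^+ k / (1 + v).
have eE : u / (1 + v) - u * ((1 - (- v) ^+ k) / (1 + v)) = e by rewrite /e; field.
have -> : 2 * complex.Re (u / (1 + v)) - 2 * complex.Re (u * ((1 - (- v) ^+ k) / (1 + v))) =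
    2 * complex.Re e.
  by rewrite -eE; move: (u / (1 + v)) (u * ((1 - (- v) ^+ k) / (1 + v))) => [x1 y1] [x2 y2] /=; ring.
rewrite ler_pM2l//.
have e2 : nsq e <= (2^-1 ^+ k) ^+ 2.
  have E : nsq e * nsq (1 + v) = nsq u * nsq v ^+ k.
    by rewrite -nsqM /e mulfVK// nsqM nsqX nsqN.
  have : nsq e * 4^-1 <= 4^-1 * (2^-1 ^+ k) ^+ 2.
    apply: (@le_trans _ _ (nsq e * nsq (1 + v))); first by rewrite ler_wpM2l ?nsq_ge0.
    rewrite E ler_pM ?nsq_ge0 ?exprn_ge0 ?nsq_ge0// -exprM mulnC exprM.
    by rewrite lerXn2r ?nnegrE ?nsq_ge0//; lra.
  by lra.
have k0 : 0 <= 2^-1 ^+ k :> R by rewrite exprn_ge0.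
have : complex.Re e ^+ 2 <= (2^-1 ^+ k) ^+ 2.
  by apply: le_trans e2; rewrite /nsq lerDl sqr_ge0.
by move=> h; apply: le_trans (ler_norm _) _; rewrite -(ger0_norm k0) -ler_sqr ?nnegrE// !real_normK ?num_real.
Qed.

(** The mean value theorem on the ray from 0 to [u] reduces this to the derivative bound and avoids
    a complex logarithm. *)
Lemma log_taylor_le u k : nsq u <= 4^-1 ->
  ln (nsq (1 + u)) - 2 * complex.Re (log_taylor k).[u] <= 2 * 2^-1 ^+ k.
Proof.
move=> u4; case: u u4 => a b u4.
pose m (t : R) := (1 + t * a) ^+ 2 + (t * b) ^+ 2.
have mE (t : R) : nsq (1 + t%:C * (a +i* b)) = m t by rewrite /nsq /m/=; ring.
have m0 (t : R) : 0 <= t <= 1 -> 0 < m t.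
  by move=> /andP[t0 t1]; move: u4; rewrite /nsq/= /m => u4; nra.
pose u := a +i* b.
pose G (t : R) := ln (m t) - 2 * complex.Re (log_taylor k).[t%:C * u].
pose G' (t : R) := 2 * complex.Re (u / (1 + t%:C * u)) -
   2 * complex.Re (u * (log_taylor k)^`().[t%:C * u]).
have dm (t : R) : is_derive t 1 m (2 * (a * (1 + t * a) + b * (t * b))).
  have dt (c : R) : is_derive t 1 (fun t : R => t * c) c.
    have := is_deriveM (is_derive_id t 1) (is_derive_cst c t 1).
    by rewrite scaler0 add0r => /is_derive_eq; apply; exact: mulr1.
  have da := is_deriveD (is_derive_cst (1 : R) t (1 : R)) (dt a).
  have := is_deriveD (is_deriveM da da) (is_deriveM (dt b) (dt b)).
  rewrite (_ : (_ + _) = m); last by apply/funext => s; rewrite /m !fctE /=; ring.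
  by move=> /is_derive_eq; apply; rewrite /GRing.scale/= !fctE; ring.
have dG (t : R) : 0 <= t <= 1 -> is_derive t 1 G (G' t).
  move=> t01; have mt := m0 t t01.
  have dln := @is_derive1_comp R (@ln R) m t _ _ (is_derive1_ln mt) (dm t).
  have [dRe _] := is_derive_horner_ray (log_taylor k) u t.
  have := is_deriveB dln (@is_deriveZ _ _ _ _ 2 _ _ _ dRe).
  move=> /is_derive_eq; apply; rewrite /G' /GRing.scale/=; congr (_ - _).
  have n0 : (1 + t * a) ^+ 2 + (t * b) ^+ 2 != 0 by exact: lt0r_neq0 mt.
  by rewrite /m /u; simpc; rewrite /=; field.
have cG : {within `[0, 1], continuous G}.
  apply: derivable_within_continuous => t; rewrite in_itv/= => t01.
  by case: (dG t t01).
have dG' (t : R) : t \in `]0, 1[ -> is_derive t 1 G (G' t).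
  by rewrite in_itv/= => /andP[t0 t1]; apply: dG; rewrite !ltW.
have [t] := MVT_segment (@ler01 R) dG' cG.
rewrite in_itv/= subr0 mulr1 => t01 E.
have : G' t <= 2 * 2^-1 ^+ k by exact: nsq_deriv_bound.
rewrite -E /G /m !mul1r !mul0r addr0 expr0n/= addr0 expr1n ln1 log_taylor0/= mulr0 !subr0.
by rewrite /nsq/= add0r.
Qed.

(** An upper bound is enough: a disc stays in the domain as soon as [psi] is bounded above along
    it. *)
Lemma log_approx (e : R) : 0 < e -> exists2 p : {poly C}, p.[0] = 0 &
  forall u, nsq u <= 4^-1 -> ln (nsq (1 + u)) - 2 * complex.Re u <= 2 * complex.Re p.[u] + e.
Proof.
move=> e0; have [k /(_ k (leqnn k)) ke] := half_expn_small 2 e0.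
exists (log_taylor k - 'X) => [|u u4]; last have uk := log_taylor_le k u4.
  by rewrite hornerD hornerN hornerX log_taylor0 subr0.
have -> : complex.Re (log_taylor k - 'X).[u] = complex.Re (log_taylor k).[u] - complex.Re u.
  by rewrite hornerD hornerN hornerX raddfB.
lra.
Qed.

End LogApproximation.

Section Profile.
Context {R : realType}.
Local Notation C := R[i].
Implicit Types (n : nat) (x : C).

(* A polynomial stand-in for [exp (- n x) (1 + n x)]: no linear term at [0]. *)
Definition profile n : {poly C} :=
  (1 - (n%:R^-1 : R)%:C *: 'X) ^+ (n ^ 2) * (1 + (n%:R : R)%:C *: 'X).

Lemma profileE n x : (profile n).[x] =
  (1 - (n%:R^-1 : R)%:C * x) ^+ (n ^ 2) * (1 + (n%:R : R)%:C * x).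
Proof. by rewrite hornerM horner_exp !hornerE. Qed.

Lemma profile0 n : (profile n).[0] = 1.
Proof. by rewrite profileE !mulr0 subr0 addr0 expr1n mulr1. Qed.

(** The linear coefficient [- n] of the power, which is [n ^ 2] times [- 1/n], cancels the
    coefficient [n] of the last factor. *)
Lemma deriv_profile0 n : (0 < n)%N -> (profile n)^`().[0] = 0.
Proof.
move=> n0; rewrite derivM deriv_exp !derivB !derivD !derivZ !derivX -polyC1 derivC sub0r add0r.
rewrite !(hornerM, hornerMn, hornerD, hornerN, hornerZ, hornerX, hornerC, horner_exp).
rewrite !mulr0 subr0 addr0 !expr1n !mulr1 !mul1r -mulr_natr natrX -!(rmorph_nat (real_complex R)).
have n0' : n%:R != 0 :> R by rewrite pnatr_eq0 -lt0n.
by rewrite -rmorphXn -rmorphN -rmorphM -rmorphD/= (_ : _ + _ = 0)//; field.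
Qed.

(** The summand 1 is the quadratic error of the power on the unit disc, and the logarithm comes from
    [|1 + n x| <= 1 + n]. *)
Definition profile_exponent n (t : R) : R := - 2 * n%:R * t + 1 + 2 * ln (1 + n%:R).

Lemma profile_le n x : (0 < n)%N -> nsq x <= 1 ->
  nsq (profile n).[x] <= expR (profile_exponent n (complex.Re x)).
Proof.
move=> n0 x1; have n0' : 0 < n%:R :> R by rewrite ltr0n.
rewrite profileE nsqM nsqX /profile_exponent expRD.
have -> : expR (2 * ln (1 + n%:R)) = (1 + n%:R) ^+ 2 :> R.
  by rewrite expRM_natl lnK// posrE; lra.
apply: ler_pM; rewrite ?exprn_ge0 ?nsq_ge0//.
- have := nsq1D_le (- ((n%:R^-1 : R)%:C * x)).
  move=> /(lerXn2r (n ^ 2)); rewrite !nnegrE nsq_ge0 expR_ge0 => /(_ isT isT).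
  move=> /le_trans; apply; rewrite -expRM_natl ler_expR nsqN nsqM nsqR natrX.
  have -> : complex.Re (- ((n%:R^-1 : R)%:C * x)) = - (n%:R^-1 * complex.Re x).
    by case: (x) => a b /=; ring.
  have -> : n%:R ^+ 2 * (2 * - (n%:R^-1 * complex.Re x) + n%:R^-1 ^+ 2 * nsq x) =
      - 2 * n%:R * complex.Re x + nsq x by field; rewrite lt0r_neq0.
  by rewrite lerD2l.
- move: x1; rewrite /nsq; case: (x) => a b /= x1.
  have a1 : a <= 1 by have := sqr_ge0 b; nra.
  have -> : (1 + (n%:R * a - 0 * b)) ^+ 2 + (0 + (n%:R * b + 0 * a)) ^+ 2 =
     1 + 2 * n%:R * a + n%:R ^+ 2 * (a ^+ 2 + b ^+ 2) by ring.
  rewrite sqrrD expr1n mul1r -addrA -[leRHS]addrA; apply: lerD => //; apply: lerD.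
    by rewrite -mulr_natl; nra.
  by rewrite ler_piMr// sqr_ge0.
Qed.

Definition profile_bound n : R := 2 * (expR (2 * n%:R + 1 + 2 * ln (1 + n%:R)) + 1).

Lemma profile_bound_ge1 n : 1 <= profile_bound n.
Proof. by rewrite /profile_bound; have := expR_ge0 (2 * n%:R + 1 + 2 * ln (1 + n%:R) : R); lra. Qed.

Lemma profileB1_le n x : (0 < n)%N -> nsq x <= 1 -> nsq ((profile n).[x] - 1) <= profile_bound n.
Proof.
move=> n0 x1; have n0' : 0 < n%:R :> R by rewrite ltr0n.
apply: le_trans (nsqD_le _ _) _; rewrite nsqN /profile_bound [leRHS]mulrDr lerD//; last first.
  by rewrite /nsq/= expr0n/= addr0 expr1n.
rewrite ler_pM2l//; apply: le_trans (profile_le n0 x1) _; rewrite ler_expR /profile_exponent.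
have : -1 <= complex.Re x by move: x1; rewrite /nsq; have := sqr_ge0 (complex.Im x); nra.
by nra.
Qed.

End Profile.

Section Disc.
Context {R : realType}.
Local Notation C := R[i].
Local Notation C3 := 'rV[C]_3.
Implicit Types (n m : nat) (x : C) (z : C3).
Variables (N : nat -> nat) (s dlt : nat -> R).
(** The smoothing must not spoil the upper bound along the disc: for [Re x <= 1] the exponent of the
    profile is at least [- 2 N], so the bound for [|f|^2] never drops below [tau]. *)
Let tau n : R := expR (- (2 * (N n)%:R)).
Hypothesis N_gt0 : forall n, (0 < N n)%N.
Hypothesis s_gt0 : forall n, 0 < s n.
Hypothesis s_le1 : forall n, s n * profile_bound (N n) <= 1.
Hypothesis s_small : forall m n, (m < n)%N -> s n * profile_bound (N n) <= s m / 2.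
Hypothesis dlt_gt0 : forall n, 0 < dlt n.
Hypothesis dlt_tail : forall n m z, (n < m)%N -> nsq (z 0 0) <= 1 ->
  `|dlt m * pot s tau m z| <= dlt n * 2^-1 ^+ m.

(** In units of [dlt n], the exponent must offset [1 + 2 ln (1 + N)] from the profile, 1 from the
    potentials below [n], 1 from those above and 1 from replacing an exponential by a power. Twice
    [A n] exceeds this total by 2. *)
Let A n : R := 3 + ln (1 + (N n)%:R).
Let Psi := psi s tau dlt.
Hypothesis dltA : forall n, dlt n * A n <= 2^-1.

Lemma sqmE (c d : R) j z : sqm c d j z = nsq (c%:C + d%:C * z 0 j).
Proof. by rewrite /sqm /nsq; case: (z 0 j) => a b /=; ring. Qed.

Lemma sqm01E j z : sqm 0 1 j z = nsq (z 0 j).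
Proof. by rewrite sqmE add0r mul1r. Qed.

Lemma nsq_scale_Re (t : R) x : complex.Re (t%:C * x) = t * complex.Re x.
Proof. by case: x => a b /=; ring. Qed.

(** For [|v| <= 1/2] one has [|1 + v|^2 >= 1/4 >= tau m], the last because [N m >= 1]; so the
    smoothing is inactive. *)
Lemma pot_near0 m z : nsq (z 0 0) <= (s m / 2) ^+ 2 ->
  pot s tau m z = ln (nsq (1 + (s m)^-1%:C * z 0 0)) - 2 * complex.Re ((s m)^-1%:C * z 0 0).
Proof.
move=> zs; rewrite /pot sqmE nsq_scale_Re.
set v := (s m)^-1%:C * z 0 0.
have v4 : nsq v <= 4^-1.
  rewrite /v nsqM nsqR; have -> : 4^-1 = (s m)^-1 ^+ 2 * (s m / 2) ^+ 2.
    by field; rewrite lt0r_neq0.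
  by rewrite ler_wpM2l// sqr_ge0.
have w4 : 4^-1 <= nsq (1 + v) by move: v4; rewrite /nsq; case: v => c d /=; nra.
have t4 : tau m <= 4^-1.
  rewrite /tau expRN lef_pV2 ?posrE ?expR_gt0//.
  have N1 : 1 <= (N m)%:R :> R by rewrite ler1n.
  have e1 : 1 + (N m)%:R <= expR (N m)%:R :> R by exact: expR_ge1Dx.
  rewrite mulrC -[2]/(2%:R) expRM_natr.
  have e2 : 2 <= expR (N m)%:R :> R by lra.
  by rewrite expr2; nra.
have t0 : 0 < tau m by exact: expR_gt0.
rewrite lnqE; last by rewrite mulrC ler_pdivlMr// mul1r; exact: le_trans w4.
rewrite lnM ?posrE ?invr_gt0//; last by apply: lt_le_trans w4.
by rewrite lnV ?posrE//; ring.
Qed.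

Lemma potentials_below n : exists2 G : {poly C}, G.[0] = 0 & forall z,
  nsq (z 0 0) <= (s n * profile_bound (N n)) ^+ 2 ->
  series (fun m => dlt m * pot s tau m z) n <= 2 * complex.Re G.[z 0 0] + dlt n.
Proof.
have sB0 : 0 <= s n * profile_bound (N n).
  by apply: mulr_ge0; [exact: ltW|exact: le_trans ler01 (profile_bound_ge1 _)].
(* The number of terms and the error are generalised: each new term takes half of the error allowed,
   and the rest goes to the earlier terms. *)
suff H k e : (k <= n)%N -> 0 < e -> exists2 G : {poly C}, G.[0] = 0 & forall z,
    nsq (z 0 0) <= (s n * profile_bound (N n)) ^+ 2 ->
    series (fun m => dlt m * pot s tau m z) k <= 2 * complex.Re G.[z 0 0] + e.
  exact: (H n (dlt n)).
elim: k e => [|k IH] e kn e0.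
  by exists 0; rewrite ?horner0// => z _; rewrite /series/= big_geq// horner0/=; lra.
have e20 : 0 < e / 2 by lra.
have [G G0 HG] := IH (e / 2) (ltnW kn) e20.
have [p p0 Hp] := log_approx (divr_gt0 e20 (dlt_gt0 k)).
exists (G + (dlt k)%:C *: (p \Po ((s k)^-1%:C *: 'X))) => [|z zs].
  by rewrite hornerD G0 hornerZ horner_comp hornerZ hornerX mulr0 p0 mulr0 addr0.
have zk : nsq (z 0 0) <= (s k / 2) ^+ 2.
  apply: le_trans zs _; rewrite lerXn2r ?nnegrE//; first by rewrite divr_ge0// ltW.
  exact: s_small.
have v4 : nsq ((s k)^-1%:C * z 0 0) <= 4^-1.
  rewrite nsqM nsqR; have -> : 4^-1 = (s k)^-1 ^+ 2 * (s k / 2) ^+ 2.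
    by field; rewrite lt0r_neq0.
  by rewrite ler_wpM2l// sqr_ge0.
rewrite /series/= big_nat_recr//= pot_near0//.
rewrite hornerD hornerZ horner_comp hornerZ hornerX.
have := Hp _ v4; have := HG z zs; rewrite /series/=.
set v := (s k)^-1%:C * z 0 0; set S := \sum_(0 <= _ < k) _.
have -> : complex.Re (G.[z 0 0] + (dlt k)%:C * p.[v]) =
    complex.Re G.[z 0 0] + dlt k * complex.Re p.[v].
  by rewrite -nsq_scale_Re raddfD.
move: (ln _ - _) (complex.Re p.[v]) (complex.Re G.[_]) => L P Q h1 h2.
have h3 : dlt k * L <= dlt k * (2 * P) + e / 2.
  have -> : dlt k * (2 * P) + e / 2 = dlt k * (2 * P + e / 2 / dlt k).
    by field; rewrite lt0r_neq0.
  by rewrite ler_pM2l.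
lra.
Qed.

Lemma lnq_le_ln (x y : R) : x <= y -> 1 <= y -> lnq x <= ln y.
Proof.
move=> xy y1; rewrite /lnq ler_ln ?posrE ?smax_gt0//; last by lra.
by apply: le_trans (smax_le x) _; rewrite ge_max xy.
Qed.

Lemma pot_profile_le n x z : nsq x <= 1 ->
  z 0 0 = (s n)%:C * ((profile (N n)).[x] - 1) ->
  pot s tau n z <= profile_exponent (N n) (complex.Re x) - 2 * complex.Re ((profile (N n)).[x] - 1).
Proof.
move=> x1 zE; rewrite /pot sqmE zE nsq_scale_Re.
set f := (profile _).[x].
have s0 := lt0r_neq0 (s_gt0 n).
have -> : (1 : R)%:C + (s n)^-1%:C * ((s n)%:C * (f - 1)) = f.
  by rewrite mulrA -rmorphM/= mulVf// mul1r addrC subrK.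
have -> : 2 / s n * (s n * complex.Re (f - 1)) = 2 * complex.Re (f - 1) by field.
rewrite lerD2r /tau expRK -lerBrDr opprK.
have -> : profile_exponent (N n) (complex.Re x) + 2 * (N n)%:R =
    ln (expR (profile_exponent (N n) (complex.Re x) + 2 * (N n)%:R)) by rewrite expRK.
have [r0 r1] : -1 <= complex.Re x /\ complex.Re x <= 1.
  by move: x1; rewrite /nsq; have := sqr_ge0 (complex.Im x); split; nra.
have n0 : 0 <= (N n)%:R :> R by [].
apply: lnq_le_ln.
  rewrite -expRN opprK [leRHS]expRD mulrC ler_pM2r ?expR_gt0//.
  exact: profile_le.
rewrite -[X in X <= _]expR0 ler_expR /profile_exponent.
have : 0 <= ln (1 + (N n)%:R) :> R by rewrite ln_ge0// lerDl.
by nra.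
Qed.

Lemma psi_disc_le n : exists2 G : {poly C}, G.[0] = 0 & forall x z, nsq x <= 1 ->
  z 0 0 = (s n)%:C * ((profile (N n)).[x] - 1) ->
  nsq (z 0 0) <= 1 /\
  Psi z <= 2 * complex.Re G.[z 0 0] + 2 * dlt n +
    dlt n * (profile_exponent (N n) (complex.Re x) - 2 * complex.Re ((profile (N n)).[x] - 1)).
Proof.
have [G G0 HG] := potentials_below n; exists G => // x z x1 zE.
have B1 : 1 <= profile_bound (N n) :> R by exact: profile_bound_ge1.
have B0 : 0 <= profile_bound (N n) :> R by lra.
have zs : nsq (z 0 0) <= (s n * profile_bound (N n)) ^+ 2.
  rewrite zE nsqM nsqR exprMn ler_wpM2l ?sqr_ge0//.
  apply: le_trans (profileB1_le (N_gt0 n) x1) _.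
  (* [profile_bound] bounds a squared modulus; being at least 1, it is at most its own square. *)
  by rewrite expr2 ler_peMl.
have z1 : nsq (z 0 0) <= 1.
  apply: le_trans zs _; by rewrite expr_le1// mulr_ge0// ltW.
split=> //.
(* The tail starts at [n.+1], so the factor 2 of the geometric sum is absorbed and the later
   potentials cost at most [dlt n]. *)
have tail := series_tail_le (u := fun m => dlt m * pot s tau m z) (ltW (dlt_gt0 n))
  (fun m nm => dlt_tail nm z1) (leqnn n.+1).
have := HG z zs; have := pot_profile_le x1 zE.
rewrite -(ler_pM2l (dlt_gt0 n)) => h1 h2.
have h3 : Psi z - series (fun m => dlt m * pot s tau m z) n.+1 <= dlt n.
  apply: le_trans (ler_norm _) _; apply: le_trans tail _.
  rewrite exprS mulrA -[dlt n * 2 * 2^-1]mulrA mulfV// mulr1.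
  by rewrite ler_piMr ?exprn_ile1 ?(ltW (dlt_gt0 n))//; lra.
have h4 : series (fun m => dlt m * pot s tau m z) n.+1 =
    series (fun m => dlt m * pot s tau m z) n + dlt n * pot s tau n z.
  by rewrite /series/= big_nat_recr.
rewrite h4 in h3; move: h1 h2 h3.
move: (Psi z) (series _ _) (dlt n * pot s tau n z) => P S Q; lra.
Qed.

Lemma disc n : let d := dlt n * A n in exists phi : C -> C3,
  [/\ holomorphic_on (@unit_disc R) phi,
      forall x, unit_disc x -> Omega Psi (phi x),
      phi 0 = row3 0 0 (1 - d)%:C &
      derive1 phi 0 = ((1 - d) * (dlt n * (N n)%:R))%:C *: row3 0 0 1].
Proof.
move=> d; have [G G0 HG] := psi_disc_le n.
have s0 := s_gt0 n; have d0 := dlt_gt0 n.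
have ln0 : 0 <= ln (1 + (N n)%:R) :> R by rewrite ln_ge0// lerDl.
have d12 : d <= 2^-1 by exact: dltA.
pose f : {poly C} := profile (N n).
have [Z ZE] : exists Z : {poly C}, Z = (s n)%:C *: (f - 1) by eexists.
(* [2 Re Y] cancels the harmonic part of the bound for [psi]. Its derivative at 0 is [dlt n * N n],
   since the profile and hence [Z] have no linear term. *)
have [Y YE] : exists Y : {poly C},
  Y = (dlt n)%:C *: (((N n)%:R : R)%:C *: 'X + (f - 1)) - (G \Po Z) by eexists.
have [K K0 HK] := horner_bounded Y.
(* [W] stands in for [(1 - d) exp Y]; this [k] makes the quadratic error [nsq Y / k] at most
   [dlt n]. *)
pose k := (Num.truncn (K / dlt n)).+1.
have k0 : 0 < k%:R :> R by rewrite ltr0n.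
have Kk : K / k%:R <= dlt n.
  rewrite ler_pdivrMr// mulrC -ler_pdivrMr//.
  by apply: le_trans (ltW (truncnS_gt _)).
pose W : {poly C} := (1 - d)%:C *: (1 + (k%:R^-1 : R)%:C *: Y) ^+ k.
have f0 : f.[0] - 1 = 0 by rewrite profile0 subrr.
have Z0 : Z.[0] = 0 by rewrite ZE hornerZ hornerD hornerN -polyC1 hornerC f0 mulr0.
have Y0 : Y.[0] = 0.
  rewrite YE !(hornerD, hornerN, hornerZ, hornerX, horner_comp) -polyC1 !hornerC f0.
  by rewrite Z0 G0 !mulr0 addr0 mulr0 subr0.
have Z'0 : Z^`().[0] = 0.
  by rewrite ZE derivZ derivB -polyC1 derivC subr0 hornerZ deriv_profile0// mulr0.
have Y'0 : Y^`().[0] = (dlt n * (N n)%:R)%:C.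
  rewrite YE derivB derivZ derivD derivZ derivX derivB -polyC1 derivC subr0 deriv_comp.
  rewrite !(hornerD, hornerN, hornerZ, hornerM, hornerC) Z'0 mulr0 subr0 deriv_profile0// addr0.
  by rewrite mulr1 rmorphM.
have W0 : W.[0] = (1 - d)%:C.
  rewrite /W hornerZ horner_exp hornerD hornerZ Y0 -polyC1 hornerC mulr0 addr0.
  by rewrite expr1n mulr1.
have W'0 : W^`().[0] = ((1 - d) * (dlt n * (N n)%:R))%:C.
  rewrite /W derivZ deriv_exp derivD -polyC1 derivC add0r derivZ.
  rewrite !(hornerZ, hornerMn, hornerM, horner_exp, hornerD, hornerC) Y0 Y'0.
  rewrite mulr0 addr0 expr1n mulr1 -mulr_natr -(rmorph_nat (real_complex R)) -!rmorphM/=.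
  by congr (_%:C); field; exact: lt0r_neq0.
pose phi x := row3 Z.[x] 0%:P.[x] W.[x].
have dphi x : is_derive x (1 : C) phi _ := is_derive_curve Z 0%:P W x.
exists phi; split.
- by move=> x _; case: (dphi x).
- move=> x; rewrite /unit_disc/= norm_nsq (_ : 1 = (1 : R)%:C)// ltcR => x1.
  have {}x1 : nsq x <= 1 by move: x1; rewrite -[ltRHS]sqrtr1 ltr_sqrt// => /ltW.
  have z0 : phi x 0 0 = (s n)%:C * (f.[x] - 1).
    by rewrite row3E ZE hornerZ hornerD hornerN -polyC1 hornerC.
  have [z1 Hpsi] := HG x (phi x) x1 z0.
  rewrite /Omega/= /rfun !sqm01E flat_ramp_eq0; last by lra.
  rewrite !row3E hornerC [nsq 0](_ : _ = 0); last by rewrite /nsq/= expr0n/= addr0.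
  rewrite !addr0 subr_lt0.
  have WY : nsq W.[x] <= expR (- 2 * d + 2 * complex.Re Y.[x] + dlt n).
    rewrite /W hornerZ horner_exp hornerD hornerZ -polyC1 hornerC nsqM nsqX nsqR.
    have -> : - 2 * d + 2 * complex.Re Y.[x] + dlt n =
      2%:R * - d + k%:R * ((2 * complex.Re Y.[x] + dlt n) / k%:R).
      by field; exact: lt0r_neq0.
    rewrite expRD !expRM_natl; apply: ler_pM; [exact: sqr_ge0|by rewrite exprn_ge0 ?nsq_ge0| |].
      have dexp : 1 - d <= expR (- d) by exact: expR_ge1Dx.
      by rewrite lerXn2r ?nnegrE ?expR_ge0//; lra.
    rewrite lerXn2r ?nnegrE ?nsq_ge0 ?expR_ge0//.
    apply: le_trans (nsq1D_le _) _; rewrite ler_expR nsq_scale_Re nsqM nsqR.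
    have -> : 2 * (k%:R^-1 * complex.Re Y.[x]) + k%:R^-1 ^+ 2 * nsq Y.[x] =
        (2 * complex.Re Y.[x] + nsq Y.[x] / k%:R) / k%:R by field; exact: lt0r_neq0.
    rewrite ler_pM2r ?invr_gt0// lerD2l; apply: le_trans Kk.
    by rewrite ler_pM2r ?invr_gt0//; exact: HK.
  apply: (@le_lt_trans _ _ (expR (- 2 * d + 2 * complex.Re Y.[x] + dlt n) * expR (Psi (phi x)))).
    by rewrite ler_wpM2r ?expR_ge0.
  rewrite -expRD -[ltRHS]expR0 ltr_expR.
  have ReY : complex.Re Y.[x] = dlt n * ((N n)%:R * complex.Re x + complex.Re (f.[x] - 1)) -
      complex.Re G.[Z.[x]].
    rewrite YE !(hornerD, hornerN, hornerZ, hornerX, horner_comp) -polyC1 !hornerC.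
    have ReB (u v : C) : complex.Re (u - v) = complex.Re u - complex.Re v by exact: raddfB.
    have ReD (u v : C) : complex.Re (u + v) = complex.Re u + complex.Re v by exact: raddfD.
    by rewrite ReB nsq_scale_Re ReD nsq_scale_Re.
  move: Hpsi; rewrite [phi x 0 0]row3E ReY /profile_exponent /d /A -/f.
  move: (Psi _) (complex.Re G.[_]) (complex.Re (f.[x] - 1)) (complex.Re x) (ln _) => P Q F r L.
  (* All harmonic and logarithmic terms cancel, and at most [- 2 * dlt n] remains. *)
  by move: d0; nra.
- by rewrite /phi Z0 W0 hornerC.
- rewrite derive1E (@derive_val _ _ _ _ _ _ _ (dphi 0)) Z'0 W'0 derivC horner0.
  by apply: row3P; rewrite !mxE/= ?mulr0 ?mulr1.
Qed.

End Disc.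

(** * Choice of degrees, scales and weights *)

Section Sequences.
Context {R : realType}.
Implicit Types (B C : nat -> R).

(** The factor 1/2 is reserved for [1 - delta n], which multiplies the derivative of the disc. *)
Lemma nat_beats_log (c : R) : 0 < c ->
  exists2 N : nat, (0 < N)%N & c * (3 + ln (1 + N%:R)) <= N%:R / 2.
Proof.
move=> c0; pose M := (Num.truncn (10 * c)).+1.
have cM : 10 * c < M%:R by exact: truncnS_gt.
have M1 : 1 <= M%:R :> R by rewrite ler1n.
exists (M ^ 2)%N; rewrite ?expn_gt0// natrX.
have lnM : ln (1 + M%:R ^+ 2) <= 2 * M%:R :> R.
  have p0 : 0 < 1 + M%:R ^+ 2 :> R by have := sqr_ge0 (M%:R : R); lra.
  rewrite -[leRHS]expRK ler_ln ?posrE ?expR_gt0//.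
  rewrite mulrC -[2]/(2%:R) expRM_natr.
  apply: (@le_trans _ _ ((1 + M%:R) ^+ 2)); first by nra.
  by rewrite lerXn2r ?nnegrE ?expR_ge0 ?expR_ge1Dx//; lra.
have : c * (3 + ln (1 + M%:R ^+ 2)) <= c * (5 * M%:R) by rewrite ler_pM2l//; lra.
by nra.
Qed.

Lemma shrinking_scales B : (forall n, 1 <= B n) -> exists s : nat -> R,
  [/\ forall n, 0 < s n, forall n, s n * B n <= 1 &
      forall m n, (m < n)%N -> s n * B n <= s m / 2].
Proof.
move=> B1; have B0 n : 0 < B n by exact: lt_le_trans (B1 n).
(* The product makes [s n.+1 * B n.+1] exactly half of [s n]; monotonicity then covers all earlier
   indices. *)
pose s n := \prod_(i < n.+1) (2 * B i)^-1.
have s0 n : 0 < s n by apply: prodr_gt0 => i _; rewrite invr_gt0 mulr_gt0.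
have sS n : s n.+1 * B n.+1 = s n / 2.
  by rewrite /s big_ord_recr/=; field; rewrite lt0r_neq0.
have sle n : s n.+1 <= s n.
  have : s n.+1 <= s n.+1 * B n.+1 by rewrite ler_peMr// ltW.
  by rewrite sS; have := s0 n; lra.
have smono m n : (m <= n)%N -> s n <= s m.
  elim: n => [|n IH]; first by rewrite leqn0 => /eqP ->.
  rewrite leq_eqVlt => /orP[/eqP -> //|]; rewrite ltnS => /IH; exact: le_trans.
have s_small m n : (m < n)%N -> s n * B n <= s m / 2.
  by case: n => // n; rewrite ltnS => mn; rewrite sS ler_pM2r// smono.
have s00 : s 0%N * B 0%N = 2^-1.
  by rewrite /s big_ord_recr big_ord0/=; field; rewrite lt0r_neq0.
have s0le : s 0%N <= 1.
  have : s 0%N <= s 0%N * B 0%N by rewrite ler_peMr// ltW.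
  by rewrite s00; lra.
exists s; split=> // -[|n]; first by rewrite s00; lra.
by have := s_small 0%N n.+1 isT; lra.
Qed.

Lemma shrinking_weights C : (forall n, 0 <= C n) -> exists d : nat -> R,
  [/\ forall n, 0 < d n, forall n, d n * C n <= 2^-1 ^+ n.+1 &
      forall m n, (m < n)%N -> d n * C n <= d m * 2^-1 ^+ n].
Proof.
move=> C0; have C1 n : 0 < 1 + C n by rewrite ltr_pwDl.
(* Dividing by [1 + C i] rather than [C i] absorbs [C i] and also keeps each factor at most 1, so
   that [d] is nonincreasing. *)
pose d n := \prod_(i < n.+1) (2^-1 ^+ i.+1 / (1 + C i)).
have h0 n : 0 < 2^-1 ^+ n :> R by rewrite exprn_gt0.
have d0 n : 0 < d n by apply: prodr_gt0 => i _; rewrite divr_gt0.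
have h1 n : 2^-1 ^+ n <= 1 :> R by rewrite exprn_ile1//; lra.
have dS n : d n.+1 * C n.+1 <= d n * 2^-1 ^+ n.+2.
  rewrite /d big_ord_recr/= -/(d n) -mulrA ler_pM2l// -mulrA ger_pMr//.
  by rewrite mulrC ler_pdivrMr// mul1r lerDr.
have dle n : d n.+1 <= d n.
  rewrite /d big_ord_recr/= -/(d n) ger_pMr// ler_pdivrMr// mul1r.
  by apply: le_trans (h1 _) _; rewrite lerDl.
have dmono m n : (m <= n)%N -> d n <= d m.
  elim: n => [|n IH]; first by rewrite leqn0 => /eqP ->.
  rewrite leq_eqVlt => /orP[/eqP -> //|]; rewrite ltnS => /IH; exact: le_trans.
have d00 : d 0%N * C 0%N <= 2^-1.
  rewrite /d big_ord_recr big_ord0/= mul1r expr1 -mulrA ger_pMr//.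
  by rewrite mulrC ler_pdivrMr// mul1r lerDr.
have d01 : d 0%N <= 1.
  rewrite /d big_ord_recr big_ord0/= mul1r ler_pdivrMr// mul1r.
  by apply: le_trans (h1 _) _; rewrite lerDl.
exists d; split=> //.
- case=> [|n]; first by rewrite expr1.
  apply: le_trans (dS n) _; rewrite ler_piMl ?(ltW (h0 _))//.
  exact: le_trans (dmono 0%N n isT) d01.
- case=> [|m] [|n]//; rewrite ltnS => mn; apply: le_trans (dS n) _.
all: apply: ler_pM => //; rewrite ?(ltW (d0 _)) ?(ltW (h0 _))// ?dmono//.
all: by rewrite [leLHS]exprS ger_pMl//; lra.
Qed.

End Sequences.

Theorem theorem3 (R : realType) (a : nat -> R)
  (a_gt0 : forall n, 0 < a n)
  (a_incr : nondecreasing_seq a)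
  (a_cvg : a @ \oo --> +oo) :
  exists (Omega : set 'rV[R[i]]_3) (r : 'rV[R[i]]_3 -> R)
         (P : 'rV[R[i]]_3) (delta : nat -> R),
    [/\ bounded_domain Omega, defining_function r Omega,
        pseudoconvex r Omega & infinite_type r Omega] /\
    [/\ boundary Omega P,
        forall n, 0 < delta n,
        decreasing_seq delta,
        delta @ \oo --> 0 &
        let nu := unit_outward_normal r P in
        forall n, let P_n := P - (delta n)%:C *: nu in
          Omega P_n /\
          (kobayashi_metric Omega P_n nu <= (1 / (a n * delta n))%:E)%E].
Proof.
have /choice[N HN] n : exists N : nat, (0 < N)%N /\ a n * (3 + ln (1 + N%:R)) <= N%:R / 2.
  by have [N N0 HN] := nat_beats_log (a_gt0 n); exists N.
have N_gt0 n : (0 < N n)%N by case: (HN n).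
pose B n : R := profile_bound (N n).
have [s [s_gt0 s_le1 s_small]] := @shrinking_scales R B (fun n => profile_bound_ge1 (N n)).
pose tau n : R := expR (- (2 * (N n)%:R)).
have tau_gt0 n : 0 < tau n by exact: expR_gt0.
have tau_le1 n : tau n <= 1.
  by rewrite /tau -[leRHS]expR0 ler_expR oppr_le0 mulr_ge0.
pose A n : R := 3 + ln (1 + (N n)%:R).
have A_ge3 n : 3 <= A n by rewrite /A lerDl ln_ge0// lerDl.
have A_gt0 n : 0 < A n by have := A_ge3 n; lra.
have /choice[D HD] n : exists D : R, forall vs z, (size vs <= n)%N ->
    (forall v, List.In v vs -> `|v| <= (n%:R : R)%:C) -> `|z| <= (n%:R : R)%:C ->
    `|rderives vs (pot s tau n) z| <= D.
  have [D HD] := Ck_family_rderives_bound n%:R n%:R (pot_US s tau n n).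
  by exists D => vs z; exact: HD.
(* One weight must tame the derivatives of the potential and also make [dlt n * A n] small and
   decreasing; the sum dominates both. *)
pose C n := `|D n| + A n.
have DC n : D n <= C n by have := ler_norm (D n); have := A_ge3 n; rewrite /C; lra.
have AC n : A n <= C n by rewrite /C lerDr.
have [n|dlt [dlt_gt0 dltC dlt_tailC]] := @shrinking_weights R C.
  by rewrite addr_ge0// ltW.
have dlt_ge0 n : 0 <= dlt n by exact: ltW.
have dlt_dom : dominated (fun m z => dlt m * pot s tau m z).
  move=> m vs z vsm vsV zM; rewrite rderives_scale; last exact: Coo_smooth (pot_US s tau m).
  rewrite normrM ger0_norm//; apply: (@le_trans _ _ (dlt m * C m)).
    by rewrite ler_pM2l//; exact: le_trans (HD m vs z vsm vsV zM) (DC m).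
  by apply: le_trans (dltC m) _; rewrite exprS ger_pMl ?exprn_gt0//; lra.
have dlt_tail n m (z : 'rV[R[i]]_3) : (n < m)%N -> nsq (z 0 0) <= 1 ->
    `|dlt m * pot s tau m z| <= dlt n * 2^-1 ^+ m.
  move=> nm z1; rewrite normrM ger0_norm//; apply: le_trans (dlt_tailC n m nm).
  rewrite ler_pM2l//; apply: le_trans (DC m).
  rewrite (@pot_dep _ s tau m z (row3 (z 0 0) 0 0)) ?row3E//.
  apply: (HD m [::]) => //.
  (* As [n < m], the ball of radius [m] contains the unit disc, so the bound [D m] applies with no
     derivative taken. *)
  have m1 : 1 <= m%:R :> R by rewrite ler1n; case: (m) nm.
  apply: norm_row_le; first by rewrite lecR ler0n.
  apply: row3_ind; rewrite row3E; [|by rewrite normr0 lecR..].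
  rewrite norm_nsq lecR; apply: le_trans m1.
  by rewrite -[leRHS]sqrtr1 ler_wsqrtr.
pose Psi := psi s tau dlt.
have PsiS : Coo Psi by exact: psi_US.
have PsiJ w : jet w Psi _ _ := psi_jet dlt_dom w.
have Psi_sh := psi_sh tau_gt0 dlt_ge0 dlt_dom.
have Psi_dep (z z' : 'rV[R[i]]_3) : z 0 0 = z' 0 0 -> Psi z = Psi z' := @psi_dep R s tau dlt z z'.
have Psi0 (z : 'rV[R[i]]_3) : z 0 0 = 0 -> Psi z = 0 by exact: psi_at0.
have Psi10 (w z : 'rV[R[i]]_3) : z 0 0 = 0 -> psi1 s tau dlt w z = 0 by exact: psi1_at0.
pose delta n := dlt n * A n.
have delta_le n : delta n <= 2^-1 ^+ n.+1.
  by apply: le_trans (dltC n); rewrite ler_pM2l.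
have delta_gt0 n : 0 < delta n by exact: mulr_gt0.
have delta_half n : delta n <= 2^-1.
  by apply: le_trans (delta_le n) _; rewrite exprS ger_pMr// exprn_ile1//; lra.
exists (Omega Psi), (rfun Psi), (row3 0 0 1), delta; split.
  split.
  - exact: bounded_domain_Omega.
  - exact: rfun_defining.
  - exact: rfun_pseudoconvex.
  - exact: Omega_infinite_type.
have nuE : unit_outward_normal (rfun Psi) (row3 0 0 1) = row3 0 0 1 by exact: normal_pole.
split.
- exact: boundary_pole.
- by [].
- apply/decreasing_seqP => n; rewrite /delta.
  apply: (@le_lt_trans _ _ (dlt n * 2^-1 ^+ n.+1)).
    by apply: le_trans (dlt_tailC n n.+1 (leqnn _)); rewrite ler_pM2l.
  rewrite ltr_pM2l//; have : 2^-1 ^+ n.+1 <= 1 :> R by rewrite exprn_ile1//; lra.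
  by have := A_ge3 n; lra.
- apply/cvgrPdist_le => e e0; have [K HK] := half_expn_small 1 e0.
  exists K => // n Kn /=; rewrite sub0r normrN ger0_norm ?(ltW (delta_gt0 n))//.
  apply: le_trans (delta_le n) _; apply: le_trans (ltW (HK n Kn)).
  by rewrite mul1r exprS ger_pMl ?exprn_gt0//; lra.
- rewrite nuE => /= n.
  have [phi [hphi phiO phi0 dphi]] := disc N_gt0 s_gt0 s_le1 s_small dlt_gt0 dlt_tail delta_half n.
  have PnE : row3 0 0 1 - (delta n)%:C *: row3 0 0 1 = row3 0 0 (1 - delta n)%:C :> 'rV[R[i]]_3.
    by apply: row3P; rewrite !mxE/= ?mulr0 ?subr0// mulr1 rmorphB.
  rewrite PnE; split.
    rewrite -phi0; apply: phiO; rewrite /unit_disc/= normr0; exact: ltr01.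
  have N0 : 0 < (N n)%:R :> R by rewrite ltr0n.
  have dh := delta_half n; have d1 : 0 < 1 - delta n by lra.
  pose al := ((1 - delta n) * (dlt n * (N n)%:R))^-1.
  have al0 : 0 < al by rewrite invr_gt0 !mulr_gt0.
  apply: (@le_trans _ _ al%:E); last first.
    (* After inversion the claim is [a n * delta n <= (1 - delta n) * (dlt n * N n)]. The weight
       cancels, and [1 - delta n >= 1/2] meets the factor reserved in the choice of [N]. *)
    rewrite lee_fin div1r /al lef_pV2 ?posrE ?mulr_gt0//.
    have [_ aN] := HN n; rewrite /delta mulrCA [leRHS]mulrCA ler_pM2l//.
    by apply: le_trans aN _; rewrite mulrC ler_pM2r// -/(delta n); lra.
  apply: ereal_inf_lbound; exists al => //; split=> //.
  by exists phi; split=> //; rewrite dphi /al invrK.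
Qed.
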